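(* Let $\Bbbk$ be an algebraically closed field of characteristic zero, let $H$ be a semisimple Hopf algebra over $\Bbbk$, and let $\tau$ be a Hopf algebra automorphism of $H$ of finite order $r$. For a finite-dimensional left $H$-module $V$ let $\chi_V$ denote its character. (1) Let $V$ be a finite-dimensional left $H$-module. If the twisted exponent $\exp_\tau(V)$ is finite, then the function $m\mapsto\nu_m(\chi_V,\tau)$, defined for $m\in r\mathbb N$, is periodic with period $r\exp_\tau(V)$, i.e. $\nu_{m+r\exp_\tau(V)}(\chi_V,\tau)=\nu_m(\chi_V,\tau)$ for all $m\in r\mathbb N$, and $\nu_m(\chi_V,\tau)\in\mathbb Z[\zeta_{\exp_\tau(V)}]$ for all $m\in r\mathbb N$. (2) If the twisted exponent $\exp_\tau(H)$ is finite, then for every finite-dimensional left $H$-module $V$ the function $m\mapsto\nu_m(\chi_V,\tau)$ on $r\mathbb N$ is periodic with period $r\exp_\tau(H)$, and $\nu_m(\chi_V,\tau)\in\mathbb Z[\zeta_{\exp_\tau(H)}]$ for all $m\in r\mathbb N$.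
   Context: $\mathbb N$ denotes the positive integers and $r\mathbb N$ the positive multiples of $r$. $\zeta_n\in\Bbbk$ denotes a primitive $n$-th root of unity. $H$ has comultiplication $\Delta$, counit $\varepsilon$, antipode $S$ (bijective, as $H$ is finite-dimensional); $\Delta^{j-1}(h)=\sum_{(h)}h_1\otimes\cdots\otimes h_j$ is iterated comultiplication in Sweedler notation. Twisted exponent of a module $(V,\rho)$: $\exp_\tau(V)$ is the smallest $k\in\mathbb N$ such that, with $m=kr$ and $\sigma=S^{-2}\tau$, $$\rho\Big(\sum_{(h)}h_1\,\sigma(h_2)\,\sigma^2(h_3)\cdots\sigma^{m-1}(h_{m})\Big)=\varepsilon(h)\,1_V\quad\text{for all }h\in H,$$ and $\infty$ if no such $k$ exists. Twisted exponent of $H$: $\exp_\tau(H)$ is the smallest $k\in\mathbb N$ such that, with $m=kr$, $\sum_{(h)}h_1\sigma(h_2)\cdots\sigma^{m-1}(h_m)=\varepsilon(h)1$ for all $h\in H$, and $\infty$ if no such $k$ exists. Twisted Frobenius--Schur indicator: for $m\in r\mathbb N$, $\nu_m(\chi,\tau)=\chi(\tilde\Lambda^{[m]})$, where $\Lambda\in H$ is the unique two-sided integral with $\varepsilon(\Lambda)=1$ and $\tilde h^{[m]}=\sum_{(h)}h_1\tau(h_2)\cdots\tau^{m-1}(h_m)$. *)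

(* Defs.v *)
From HB Require Import structures.
From mathcomp Require Import all_boot all_order all_algebra all_field.

Set Implicit Arguments.
Unset Strict Implicit.
Unset Printing Implicit Defensive.

Import GRing.Theory.
Local Open Scope ring_scope.

Section Tensor.

Variable F : fieldType.
Implicit Types U V W : vectType F.

(* U (x) V in coordinates: the entry (i, j) is the coefficient of             *)
(* e_i (x) e'_j, for the bases [vbasis fullv] of U and V.                     *)
Definition tensor U V : vectType F :=
  'M[F]_(\dim (fullv : {vspace U}), \dim (fullv : {vspace V})).

Definition tens U V (u : U) (v : V) : tensor U V :=
  \matrix_(i, j) (coord (vbasis fullv) i u * coord (vbasis fullv) j v).

(* The linear map U (x) V -> W induced by a bilinear map b: if                *)
(* t = \sum u (x) v then [tlift b t] = \sum b u v.                            *)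
Definition tlift U V W (b : U -> V -> W) (t : tensor U V) : W :=
  \sum_i \sum_j
     (t : 'M_(_, _)) i j *: b (vbasis fullv)`_i (vbasis fullv)`_j.

Definition tmap U V U' V' (f : U -> U') (g : V -> V') :
    tensor U V -> tensor U' V' :=
  tlift (fun u v => tens (f u) (g v)).

Definition tassoc U V W :
    tensor (tensor U V) W -> tensor U (tensor V W) :=
  tlift (fun s w => tlift (fun u v => tens u (tens v w)) s).

Definition tmul (H : falgType F) (s t : tensor H H) : tensor H H :=
  tlift (fun a b : H => tlift (fun c d : H => tens (a * c) (b * d)) t) s.

End Tensor.

(* Finite-dimensionality and 1 != 0 are part of [falgType]. *)
Record hopf_algebra (F : fieldType) (H : falgType F) := HopfAlgebra {
  comul : 'Hom(H, tensor H H);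
  counit : {scalar H};
  antipode : 'End(H);
  comulA : forall h : H,
    tassoc (tmap comul (@id H) (comul h)) = tmap (@id H) comul (comul h);
  counitl : forall h : H,
    tlift (fun a b : H => counit a *: b) (comul h) = h;
  counitr : forall h : H,
    tlift (fun a b : H => counit b *: a) (comul h) = h;
  comul1 : comul 1 = tens (1 : H) (1 : H);
  comulM : forall a b : H, comul (a * b) = tmul (comul a) (comul b);
  counit1 : counit 1 = 1;
  counitM : forall a b : H, counit (a * b) = counit a * counit b;
  antipodel : forall h : H,
    tlift (fun a b : H => antipode a * b) (comul h) = counit h *: (1 : H);
  antipoder : forall h : H,
    tlift (fun a b : H => a * antipode b) (comul h) = counit h *: (1 : H)
}.

Section Algebra.

Variables (F : fieldType) (H : falgType F).

Definition left_ideal (I : {vspace H}) : Prop := (fullv * I <= I)%VS.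

(* The left regular module is semisimple: each submodule is a summand. *)
Definition semisimple_algebra : Prop :=
  forall I : {vspace H}, left_ideal I ->
  exists J : {vspace H},
    [/\ left_ideal J, (I + J = fullv)%VS & (I :&: J = 0)%VS].

Record lmodule_str (V : vectType F) := LmoduleStr {
  lm_act :> {linear H -> 'End(V)};
  lm_act1 : lm_act 1 = \1%VF;
  lm_actM : forall a b : H, lm_act (a * b) = (lm_act a \o lm_act b)%VF
}.

Definition lfun_trace (V : vectType F) (f : 'End(V)) : F :=
  \tr (passmx.mxof (vbasis fullv) (vbasis fullv) f).

Definition lm_char (V : vectType F) (rho : lmodule_str V) (h : H) : F :=
  lfun_trace (rho h).

End Algebra.

Section Hopf.

Variables (F : fieldType) (H : falgType F) (A : hopf_algebra H).

Local Notation Delta := (comul A).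
Local Notation eps := (counit A).
Local Notation S := (antipode A).

Definition hopf_automorphism (tau : 'End(H)) : Prop :=
  [/\ bijective tau,
      tau 1 = 1 /\ (forall a b : H, tau (a * b) = tau a * tau b),
      forall h : H, Delta (tau h) = tmap tau tau (Delta h),
      forall h : H, eps (tau h) = eps h &
      forall h : H, S (tau h) = tau (S h)].

(* H^(x)(n+1) *)
Fixpoint tpow (n : nat) : vectType F :=
  if n is n'.+1 then tensor H (tpow n') else H.

(* Delta^n : H -> H^(x)(n+1) *)
Fixpoint iter_comul (n : nat) : H -> tpow n :=
  match n return H -> tpow n with
  | 0 => id
  | n'.+1 => fun h => tmap (@id H) (iter_comul n') (Delta h)
  end.

(* h_1 (x) ... (x) h_(n+1) |-> f 0 h_1 * f 1 h_2 * ... * f n h_(n+1) *)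
Fixpoint tpow_mul (n : nat) (f : nat -> H -> H) : tpow n -> H :=
  match n return tpow n -> H with
  | 0 => f 0%N
  | n'.+1 =>
      tlift (fun (a : H) (t : tpow n') => f 0%N a * tpow_mul (fun i => f i.+1) t)
  end.

(* \sum h_1 phi(h_2) phi^2(h_3) ... phi^(m-1)(h_m), meaningful for m > 0. *)
Definition twisted_power (phi : H -> H) (m : nat) (h : H) : H :=
  tpow_mul (fun i => iter i phi) (iter_comul m.-1 h).

Definition normalized_integral (Lambda : H) : Prop :=
  [/\ forall h : H, h * Lambda = eps h *: Lambda,
      forall h : H, Lambda * h = eps h *: Lambda & eps Lambda = 1].

Definition twisted_indicator (Lambda : H) (chi : H -> F) (tau : 'End(H))
    (m : nat) : F :=
  chi (twisted_power tau m Lambda).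

Definition least_pos (P : nat -> Prop) (k : nat) : Prop :=
  [/\ (0 < k)%N, P k & forall j : nat, (0 < j)%N -> P j -> (k <= j)%N].

Definition has_order (tau : 'End(H)) (r : nat) : Prop :=
  least_pos (fun k => forall h : H, iter k tau h = h) r.

(* S^-2 tau; S is bijective since H is finite-dimensional, so that the        *)
(* [inv_lfun] of S is its two-sided inverse.                                  *)
Definition twisting_map (tau : 'End(H)) : 'End(H) :=
  (S^-1 \o S^-1 \o tau)%VF.

(* "exp_tau(V) = e" and "exp_tau(H) = e" for r the order of tau and e finite; *)
(* the exponent is infinite when there is no such e.                          *)
Definition is_twisted_exponent_mod (tau : 'End(H)) (r : nat) (V : vectType F)
    (rho : lmodule_str H V) (e : nat) : Prop :=
  least_pos (fun k => forall h : H,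
    rho (twisted_power (twisting_map tau) (k * r) h) = eps h *: \1%VF) e.

Definition is_twisted_exponent (tau : 'End(H)) (r : nat) (e : nat) : Prop :=
  least_pos (fun k => forall h : H,
    twisted_power (twisting_map tau) (k * r) h = eps h *: (1 : H)) e.

End Hopf.

(* x \in Z[z] *)
Definition int_adjoin (F : fieldType) (z x : F) : Prop :=
  exists p : {poly int}, x = (map_poly intr p).[z].

(* Main.v *)
(* Everything rests on the theorem of Larson and Radford that [S^2 = 1].      *)
(*   A two-sided integral [L] with [eps L = 1] makes [p |-> p(L_2) L_1] a       *)
(* bijection from the dual of [H] to [H]; the preimage [lam] of [1] is a left   *)
(* integral, and it yields Radford's formula: [S^4] is conjugation by a        *)
(* grouplike element [g]. As [g] has finite order, so has [S^2], which is also  *)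
(* an inner automorphism. Decomposing [1] into orthogonal primitive idempotents *)
(* fixed by [S^2] writes [lam 1 = tr S^2] as a sum of squared absolute values   *)
(* of sums of roots of unity, one of which is 1, so [lam 1 <> 0]. Hence [g = 1] *)
(* and [S^4 = 1], and a divisibility argument with the regular character gives  *)
(* [S^2 = 1].                                                                   *)
(*   Now the two twists [tau] and [S^-2 tau] agree and the period is immediate, *)
(* since twisted powers are convolution powers. For integrality, let [nu] be    *)
(* the indicator at [m]. On the one hand [dim H * nu] is the trace of an        *)
(* operator [T] on [Hom(H, V)] with [T^(e+1) = T], so it lies in [Z[z_e]]. On    *)
(* the other hand [nu] is the trace of the composite of the integral with a     *)
(* cyclic shift of [V^(x)m], so it lies in [Z[z_m]]. Finally [Z[z_e]] is a pure *)
(* subgroup of [Z[z_(em)]], which is shown one prime at a time by Galois        *)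
(* conjugation.                                                                 *)
Require Import Defs.
From HB Require Import structures.
From mathcomp Require Import all_boot all_order all_algebra all_field.
From mathcomp Require cyclic.
From mathcomp Require Import zify.

Set Implicit Arguments.
Unset Strict Implicit.
Unset Printing Implicit Defensive.

Import GRing.Theory.
Local Open Scope ring_scope.

(** * Multilinear maps and traces *)

(** Write [P m] for the twisted power [tau_power A tau m], [L] for the integral, [nu] for the
    indicator at [m], and [n] for [dim H]. Once [S^2 = 1] ([anti2_id]), the map [S^-2 tau] is [tau]
    ([twisting_mapE]), so exponents and indicators speak of the same maps [P m]. For [r] dividing
    [m], [P (m + k)] is the convolution of [P m] and [P k] ([tau_powerD]), and [P (r * e)] acts on
    [V] as the counit; this is the periodicity.

    Integrality combines two weaker facts, each of which realises a scalar as the trace of an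
    operator [T] with [T^(k+1) = T] ([finite_order_trace]). Convolution by [P m] on [Hom(H, V)] has
    trace [n * nu] and [k = e] ([indicator_exponent]): the order is right, but there is a factor
    [n]. The integral followed by a cyclic shift on the m-th tensor power has trace [nu] and [k = m]
    ([indicator_integral]): no factor, but the wrong order. Purity of [Z[z_e]] in [Z[z_(em)]]
    ([int_adjoin_pure]) removes the factor.

    Besides [twisting_mapE], [S^2 = 1] supplies the cocommutativity of [L] ([int_cocomm]), which
    makes the tensor kernel invariant under rotation, and the formula [trace_lcontract], which turns
    a trace over [H] into a value at [L]. It is proved through [trace_inner_neq0] (so
    [tr S^2 <> 0]), [modg1] (so [S^4 = 1]) and the divisibility argument of [anti2_id_lam]. *)

Section Linearity.

Variable F : fieldType.
Implicit Types U V W Z : vectType F.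

(** Unbundled, because [tlift] accepts arbitrary functions and Sweedler sums are bare lambda terms;
    [lin_tac] discharges the side conditions. *)
Definition lin U W (f : U -> W) := forall k x y, f (k *: x + y) = k *: f x + f y.

Definition bilin U V W (f : U -> V -> W) :=
  (forall y, lin (f^~ y)) /\ (forall x, lin (f x)).

Lemma lin_sum U W (f : U -> W) (I : finType) (c : I -> F) (x : I -> U) :
  lin f -> f (\sum_i c i *: x i) = \sum_i c i *: f (x i).
Proof.
move=> lf; have f0: f 0 = 0.
  by have := lf (-1) 0 0; rewrite scaler0 addr0 scaleN1r addNr.
elim/big_rec2: _ => [//|i y1 y2 _ <-]; exact: lf.
Qed.

Lemma linZ U W (f : U -> W) k x : lin f -> f (k *: x) = k *: f x.
Proof. by move=> lf; have := @lin_sum _ _ f 'I_1 (fun=> k) (fun=> x) lf; rewrite !big_ord1. Qed.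

Lemma lin_comp U V W (f : V -> W) (g : U -> V) :
  lin f -> lin g -> lin (fun x => f (g x)).
Proof. by move=> lf lg k x y; rewrite lg lf. Qed.

Lemma lin_id U : lin (fun x : U => x). Proof. by []. Qed.

Lemma lin_lfun U V W (f : 'Hom(V, W)) (g : U -> V) :
  lin g -> lin (fun x => f (g x)).
Proof. by move=> lg k x y; rewrite lg linearP. Qed.

Lemma lin_scalar U V (p : {scalar V}) (g : U -> V) :
  lin g -> lin (fun x => p (g x) : F^o).
Proof. by move=> lg k x y; rewrite lg linearP. Qed.

Lemma lin_scaler U W (c : F) (g : U -> W) : lin g -> lin (fun x => c *: g x).
Proof. by move=> lg k x y; rewrite lg scalerDr !scalerA mulrC. Qed.

Lemma lin_scalel U W (p : U -> F^o) (w : W) :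
  lin p -> lin (fun x => (p x : F) *: w).
Proof. by move=> lp k x y; rewrite lp scalerDl scalerA. Qed.

Lemma lin_mull U (R : falgType F) (c : R) (g : U -> R) :
  lin g -> lin (fun x => c * g x).
Proof. by move=> lg k x y; rewrite lg mulrDr scalerAr. Qed.

Lemma lin_mulr U (R : falgType F) (c : R) (g : U -> R) :
  lin g -> lin (fun x => g x * c).
Proof. by move=> lg k x y; rewrite lg mulrDl scalerAl. Qed.

Lemma lin_bil1 U V V' W (f : V -> V' -> W) (g : U -> V) c :
  bilin f -> lin g -> lin (fun x => f (g x) c).
Proof. by move=> [lf _] lg k x y; rewrite lg lf. Qed.

Lemma lin_bil2 U V V' W (f : V -> V' -> W) (g : U -> V') c :
  bilin f -> lin g -> lin (fun x => f c (g x)).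
Proof. by move=> [_ lf] lg k x y; rewrite lg lf. Qed.

Lemma lin_linfun U W (f : U -> W) : lin f -> linfun f =1 f.
Proof.
move=> lf; pose m := GRing.isLinear.Build F U W *:%R f lf.
pose f' : {linear U -> W} := HB.pack f m.
exact: (lfunE f').
Qed.

Lemma tliftP U V W (f : U -> V -> W) : lin (tlift f).
Proof.
move=> k x y; rewrite /tlift scaler_sumr -big_split; apply: eq_bigr => i _.
rewrite scaler_sumr -big_split; apply: eq_bigr => j _ /=.
by rewrite !mxE scalerDl scalerA.
Qed.

Lemma lin_tlift U V W Z (f : U -> V -> W) (g : Z -> tensor U V) :
  lin g -> lin (fun x => tlift f (g x)).
Proof. by move=> lg k x y; rewrite lg tliftP. Qed.

Lemma lin_tlift_body U V W Z (f : Z -> U -> V -> W) (t : tensor U V) :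
  (forall a b, lin (fun x => f x a b)) -> lin (fun x => tlift (f x) t).
Proof.
move=> lf k x y; rewrite /tlift scaler_sumr -big_split; apply: eq_bigr => i _.
rewrite scaler_sumr -big_split; apply: eq_bigr => j _ /=.
by rewrite lf scalerDr !scalerA mulrC.
Qed.

Lemma eq_tlift U V W (f f' : U -> V -> W) t :
  (forall a b, f a b = f' a b) -> tlift f t = tlift f' t.
Proof.
by move=> ff; apply: eq_bigr => i _; apply: eq_bigr => j _; rewrite ff.
Qed.

(** The same congruence with the equation read in [F] rather than in the module [F^o], so that
    [sw_ext] also works on scalar-valued sums. *)
Lemma eq_tliftF U V (f f' : U -> V -> F^o) t :
  (forall a b, f a b = f' a b) -> tlift f t = tlift f' t :> F.
Proof. exact: eq_tlift. Qed.

Lemma lin_tliftE U V W W' (u : W -> W') (f : U -> V -> W) t :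
  lin u -> u (tlift f t) = tlift (fun a b => u (f a b)) t.
Proof.
move=> lu; rewrite /tlift !pair_bigA /=.
exact: (@lin_sum _ _ u _ (fun p => (t : 'M_(_, _)) p.1 p.2)
         (fun p => f (vbasis fullv)`_p.1 (vbasis fullv)`_p.2)).
Qed.

Lemma tlift_scalel U V W (f : U -> V -> F^o) t (w : W) :
  tlift (fun a b => (f a b : F) *: w) t = (tlift f t : F) *: w.
Proof.
have lw : lin (fun c : F^o => (c : F) *: w) by exact: lin_scalel (@lin_id _).
by rewrite (lin_tliftE _ _ lw).
Qed.

Lemma tliftZ U V W (f : U -> V -> W) t (c : F) :
  c *: tlift f t = tlift (fun a b => c *: f a b) t.
Proof. exact: (@lin_tliftE _ _ _ _ ( *:%R c) f t (lin_scaler c (@lin_id W))). Qed.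

Lemma tlift_tens U V W (f : U -> V -> W) u v :
  bilin f -> tlift f (tens u v) = f u v.
Proof.
move=> [lf1 lf2].
rewrite [in RHS](coord_vbasis (memvf u)) [in RHS](coord_vbasis (memvf v)).
rewrite (lin_sum _ _ (lf1 _)) /tlift; apply: eq_bigr => i _.
rewrite (lin_sum _ _ (lf2 _)) scaler_sumr; apply: eq_bigr => j _.
by rewrite mxE scalerA.
Qed.

Lemma bilin_tens U V : bilin (@tens F U V).
Proof.
split=> a k x y; apply/matrixP => i j; rewrite !mxE linearP /=.
  by rewrite mulrDl mulrA.
by rewrite mulrDr mulrCA.
Qed.

Lemma lin_tens1 U V Z (g : Z -> U) (c : V) :
  lin g -> lin (fun x => tens (g x) c).
Proof. exact: lin_bil1 (bilin_tens U V). Qed.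

Lemma lin_tens2 U V Z (g : Z -> V) (c : U) :
  lin g -> lin (fun x => tens c (g x)).
Proof. exact: lin_bil2 (bilin_tens U V). Qed.

Lemma tlift_tmap U V U' V' W (f : U' -> V' -> W) (g : U -> U') (k : V -> V') t :
  bilin f -> tlift f (tmap g k t) = tlift (fun a b => f (g a) (k b)) t.
Proof.
move=> bf; rewrite /tmap (lin_tliftE _ _ (@tliftP _ _ _ f)).
by apply: eq_tlift => a b; rewrite tlift_tens.
Qed.

Lemma tlift_exchange U V U' V' W (f : U -> V -> U' -> V' -> W) s t :
  tlift (fun a b => tlift (f a b) s) t =
  tlift (fun c d => tlift (fun a b => f a b c d) t) s.
Proof.
rewrite /tlift !pair_bigA /=.
under eq_bigr do rewrite pair_bigA scaler_sumr /=.
under [RHS]eq_bigr do rewrite pair_bigA scaler_sumr /=.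
rewrite exchange_big; apply: eq_bigr => p _; apply: eq_bigr => q _ /=.
by rewrite !scalerA mulrC.
Qed.

Lemma tlift_sum U V W (I : finType) (f : I -> U -> V -> W) t :
  tlift (fun a b => \sum_i f i a b) t = \sum_i tlift (f i) t :> W.
Proof.
rewrite /tlift [RHS]exchange_big; apply: eq_bigr => i _.
rewrite [RHS]exchange_big; apply: eq_bigr => j _; exact: scaler_sumr.
Qed.

End Linearity.

Ltac sw_ext := first [apply: eq_tlift | apply: eq_tliftF].

Ltac lin_step :=
  match goal with
  | |- bilin _ => split
  | |- forall _, _ => intro
  | |- lin _ => first
    [ apply: lin_id | assumption
    | match goal with hf : lin ?f |- lin (fun x => ?f (@?g x)) =>
        apply: (lin_comp hf (g := g)) end
    | apply: lin_lfun | apply: lin_scalar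
    | apply: lin_mull | apply: lin_mulr | apply: lin_scaler | apply: lin_scalel
    | apply: lin_tlift | apply: lin_tlift_body
    | apply: lin_tens1 | apply: lin_tens2
    | apply: lin_bil1; first eassumption | apply: lin_bil2; first eassumption ]
  end.
Ltac lin_tac := repeat lin_step.


Section Trace.

Variable F : fieldType.
Implicit Types U V W : vectType F.

Lemma lfun_traceE V (f : 'End(V)) :
  lfun_trace f = \sum_i coord (vbasis fullv) i (f (vbasis fullv)`_i).
Proof.
rewrite /lfun_trace /mxtrace; apply: eq_bigr => i _.
rewrite /passmx.mxof mxE /= /passmx.rVof mxE /passmx.vecof; congr (coord _ _ (f _)).
rewrite (bigD1 i) //= mxE !eqxx scale1r big1 ?addr0 // => j ji.
by rewrite mxE (negPf ji) andbF scale0r.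
Qed.

(** A rank-one map [v |-> p v *: y] has trace [p y]; the vectors [y k] need not form a basis. *)
Lemma trace_expand V (I : finType) (f : 'End(V)) (p : I -> V -> F^o) y :
  (forall k, lin (p k)) -> (forall v, f v = \sum_k (p k v : F) *: y k) ->
  lfun_trace f = \sum_k p k (y k).
Proof.
move=> lp fE; rewrite lfun_traceE.
under eq_bigr do rewrite fE linear_sum.
rewrite exchange_big; apply: eq_bigr => k _ /=.
rewrite [in RHS](coord_vbasis (memvf (y k))) (lin_sum _ _ (lp k)).
by apply: eq_bigr => i _; rewrite linearZ /= mulrC.
Qed.

Lemma trace_tlift V U W (f : 'End(V)) (t : tensor U W)
    (p : V -> U -> W -> F^o) y :
  (forall a b, lin (fun v => p v a b)) ->
  (forall v, f v = tlift (fun a b => (p v a b : F) *: y a b) t) ->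
  lfun_trace f = tlift (fun a b => p (y a b) a b) t.
Proof.
move=> lp fE; rewrite /tlift pair_bigA /=.
pose e := fun i => (vbasis {:U})`_i; pose e' := fun i => (vbasis {:W})`_i.
rewrite (trace_expand (I := prod 'I_(\dim {:U}) 'I_(\dim {:W}))
  (p := fun k v => (t : 'M_(_, _)) k.1 k.2 *: p v (e k.1) (e' k.2))
  (y := fun k => y (e k.1) (e' k.2))) //.
  by move=> k; apply/lin_scaler/lp.
by move=> v; rewrite fE /tlift pair_bigA; apply: eq_bigr => k _; rewrite scalerA.
Qed.

Lemma trace_idem V (f : 'End(V)) :
  (forall v, f (f v) = f v) -> lfun_trace f = (\dim (limg f))%:R.
Proof.
move=> ff; have fK v : v \in limg f -> f v = v.
  by case/memv_imgP => w _ ->.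
pose X := vbasis (limg f).
rewrite (trace_expand (p := fun k v => coord X k (f v)) (y := fun k => X`_k)).
- rewrite (eq_bigr (fun _ => 1)) ?sumr_const ?card_ord // => k _.
  rewrite fK ?vbasis_mem ?mem_nth ?size_tuple //.
  by rewrite coord_free ?eqxx // (basis_free (vbasisP _)).
- by move=> k c x y; rewrite !linearP.
by move=> v; apply: coord_vbasis; apply: memv_img; apply: memvf.
Qed.

Lemma trace_comp V (f f' : 'End(V)) :
  lfun_trace (f \o f')%VF = lfun_trace (f' \o f)%VF.
Proof.
by rewrite /lfun_trace !(passmx.mxof_comp _ _ (vbasisP _)) mxtrace_mulC.
Qed.

End Trace.

(** * Cyclotomic integers *)

Section CyclotomicIntegers.

Local Notation ev p z := ((map_poly intr p).[z]).

Lemma ev_is_rmorph (R : comNzRingType) (z : R) (p q : {poly int}) :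
  (ev (p + q) z = ev p z + ev q z) * (ev (p * q) z = ev p z * ev q z).
Proof. by rewrite rmorphD rmorphM hornerD hornerM. Qed.

Lemma evE (R : comNzRingType) (z : R) (p : {poly int}) :
  ev p z = \sum_(i < size p) (p`_i)%:~R * z ^+ i.
Proof.
rewrite (horner_coef_wide _ (size_poly _ _)); apply: eq_bigr => i _.
by rewrite coef_map.
Qed.

(** As a root of [X^n - 1], [z] is a root of some ['Phi_d] with [d] dividing [n]; then [z ^+ d = 1]
    forces [d = n]. *)
Lemma root_Cyclotomic (K : fieldType) n (z : K) :
  n.-primitive_root z -> ev 'Phi_n z = 0.
Proof.
move=> zn; have n0 := prim_order_gt0 zn.
have prodE d (x : K) : (0 < d)%N ->
    \prod_(i <- divisors d) ev 'Phi_i x = x ^+ d - 1.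
  move=> d0; rewrite -horner_prod.
  rewrite -(rmorph_prod (map_poly intr)) prod_Cyclotomic //.
  by rewrite rmorphB rmorph1 /= map_polyXn hornerD hornerN hornerXn hornerC.
have /eqP := prodE n z n0; rewrite prim_expr_order // subrr prodf_seq_eq0.
case/hasP => d; rewrite -dvdn_divisors // => dn /= /eqP zd.
have d0 := dvdn_gt0 n0 dn.
have /eqP : z ^+ d - 1 = 0.
  rewrite -prodE // (bigD1_seq d) ?divisors_uniq //= ?zd ?mul0r //.
  by rewrite -dvdn_divisors.
rewrite subr_eq0 -(prim_order_dvd zn) => nd.
by rewrite (_ : n = d) //; apply/eqP; rewrite eqn_dvd nd.
Qed.

(** Irreducibility over the rationals: a common root in [algC] is a primitive n-th root of unity,
    whose minimal polynomial is ['Phi_n]. *)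
Lemma Cyclotomic_coprime_or_dvd n (p : {poly rat}) : (0 < n)%N ->
  coprimep p (map_poly intr 'Phi_n) \/ (map_poly intr 'Phi_n %| p)%R.
Proof.
move=> n0; set f := map_poly _ _; have [z zn] := C_prim_root_exists n0.
have fC : map_poly ratr f = cyclotomic z n.
  rewrite -(Cintr_Cyclotomic zn) -map_poly_comp.
  by apply: eq_map_poly => c /=; rewrite rmorph_int.
have [|] := boolP (coprimep p f); first by left.
rewrite /coprimep -(size_map_poly (ratr : rat -> algC)) => /closed_rootP[y].
set d := gcdp p f => ry.
have rf : root (map_poly ratr f) y.
  move: ry; rewrite !root_factor_theorem => /dvdp_trans; apply.
  by rewrite dvdp_map dvdp_gcdr.
rewrite fC root_cyclotomic // in rf.
right; apply: dvdp_trans (dvdp_gcdl p f).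
have [m [mE _ mP]] := minCpolyP y.
have mf : m = f.
  apply: (map_poly_inj (ratr : {rmorphism rat -> algC})).
  by rewrite /= fC -mE (minCpoly_cyclotomic rf) -(Cintr_Cyclotomic rf)
             -(Cintr_Cyclotomic zn).
by rewrite -[gcdp p f]/d -mf -mP.
Qed.

(** Galois conjugation without a Galois group. It also crosses between fields, which later allows
    absolute values to be used in [algC]. *)
Lemma prim_root_conj (K K' : fieldType) n (z : K) (z' : K') (p : {poly int}) :
  [pchar K] =i pred0 -> [pchar K'] =i pred0 ->
  n.-primitive_root z -> n.-primitive_root z' -> ev p z = 0 -> ev p z' = 0.
Proof.
move=> /pcharf0P cK /pcharf0P cK' zn zn' pz.
have n0 := prim_order_gt0 zn; pose f := 'Phi_n.
have inj_int (L : fieldType) (cL : forall n, (n%:R == 0 :> L) = (n == 0)%N) (c : int) :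
    c != 0 -> c%:~R != 0 :> L.
  case: c => c; first by rewrite cL.
  by rewrite NegzE => _; rewrite rmorphN oppr_eq0 cL.
have [pf|] := @Cyclotomic_coprime_or_dvd n (map_poly intr p) n0.
  have [[u v] /= uv] := Bezout_eq1_coprimepP _ _ pf.
  have [U [a a0 uE]] := rat_poly_scale u; have [V [b b0 vE]] := rat_poly_scale v.
  (* Denominators are cleared so that the identity can be evaluated at [z]: the left side vanishes
     there, and the right side is a nonzero integer. *)
  have e : (b *: U) * p + (a *: V) * f = (a * b)%:P.
    apply: (map_inj_poly (intr_inj : injective (intr : int -> rat)) (rmorph0 _)).
    rewrite rmorphD !rmorphM /= !map_polyZ map_polyC /=.
    move: (congr1 ( *:%R (a * b)%:~R) uv); rewrite uE vE.
    rewrite scalerDr -!scalerAl !scalerA rmorphM /=.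
    rewrite mulrAC mulfV ?intr_eq0 // mul1r mulfK ?intr_eq0 // => ->.
    by rewrite alg_polyC map_polyC /= rmorphM.
  have := congr1 (fun q => ev q z) e.
  rewrite !ev_is_rmorph pz root_Cyclotomic // !mulr0 addr0 map_polyC hornerC /=.
  by move/esym/eqP; rewrite (negPf (inj_int K cK _ _)) ?mulf_neq0.
case/dvdpP => q qE; have [Q [a a0 QE]] := rat_poly_scale q.
have e : a *: p = Q * f.
  apply: (map_inj_poly (intr_inj : injective (intr : int -> rat)) (rmorph0 _)).
  rewrite map_polyZ /= qE QE rmorphM /= -scalerAl scalerA.
  by rewrite mulfV ?intr_eq0 // scale1r.
have := congr1 (fun q => ev q z') e.
rewrite map_polyZ /= hornerZ rmorphM /= hornerM root_Cyclotomic // mulr0.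
by move/eqP; rewrite mulf_eq0 (negPf (inj_int K' cK' _ a0)) /= => /eqP.
Qed.

Lemma sum_unity (K : fieldType) n (x : K) :
  x ^+ n = 1 -> x != 1 -> \sum_(i < n) x ^+ i = 0.
Proof.
move=> xn x1; apply/eqP; have := subrX1 x n; rewrite xn subrr => /esym/eqP.
by rewrite mulf_eq0 subr_eq0 (negPf x1).
Qed.

Lemma closed_prim_root (K : closedFieldType) n :
  [pchar K] =i pred0 -> (0 < n)%N -> exists z : K, n.-primitive_root z.
Proof.
move=> /pcharf0P cK n0; pose p : {poly K} := 'X^n - 1.
have [r Dp] := closed_field_poly_normal p.
rewrite (monicP _) ?monicXnsubC // scale1r in Dp.
have rn1 : all n.-unity_root r by apply/allP => x; rewrite -root_prod_XsubC -Dp.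
have sz_r : (n < (size r).+1)%N.
  by rewrite -(size_prod_XsubC r id) -Dp size_XnsubC.
have [|z] := hasP (cyclic.has_prim_root n0 rn1 _ sz_r); last by exists z.
by rewrite -separable_prod_XsubC -Dp separable_Xn_sub_1 // cK -lt0n.
Qed.

Section IntAdjoin.

Variables (K : fieldType) (z : K).

Lemma int_adjoin_int (c : int) : int_adjoin z c%:~R.
Proof. by exists c%:P; rewrite map_polyC hornerC. Qed.

Lemma int_adjoinD x y : int_adjoin z x -> int_adjoin z y -> int_adjoin z (x + y).
Proof. by move=> [p ->] [q ->]; exists (p + q); rewrite ev_is_rmorph. Qed.

Lemma int_adjoinM x y : int_adjoin z x -> int_adjoin z y -> int_adjoin z (x * y).
Proof. by move=> [p ->] [q ->]; exists (p * q); rewrite ev_is_rmorph. Qed.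

Lemma int_adjoinX n : int_adjoin z (z ^+ n).
Proof. by exists 'X^n; rewrite map_polyXn hornerXn. Qed.

Lemma int_adjoin_sum (I : Type) (r : seq I) (P : pred I) (f : I -> K) :
  (forall i, P i -> int_adjoin z (f i)) -> int_adjoin z (\sum_(i <- r | P i) f i).
Proof.
move=> fP; elim/big_rec: _ => [|i x Pi]; first exact: (int_adjoin_int 0).
by apply: int_adjoinD; apply: fP.
Qed.

End IntAdjoin.

Lemma int_adjoin_exp (K : fieldType) (z x : K) n :
  int_adjoin (z ^+ n) x -> int_adjoin z x.
Proof.
move=> [p ->]; rewrite evE; apply: int_adjoin_sum => i _.
by apply: int_adjoinM; [exact: int_adjoin_int | rewrite -exprM; exact: int_adjoinX].
Qed.

(** * Purity of rings of cyclotomic integers *)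

Section PurityStep.

Variables (K : fieldType) (p M : nat) (w : K).
Hypotheses (cK : [pchar K] =i pred0) (pp : prime p).
Hypothesis wP : (p * M).-primitive_root w.

(* The Galois conjugates [w ^+ (1 + M s)], where [p] does not divide         *)
(* [1 + M s], fix [w ^+ p]; the Fourier transform over [s < p] isolates the  *)
(* part of a polynomial in [w] with exponents in a given class modulo [p].   *)
Lemma int_adjoin_pure_step (n : nat) (x : K) : (0 < n)%N ->
  int_adjoin w x -> int_adjoin (w ^+ p) (n%:R * x) -> int_adjoin (w ^+ p) x.
Proof.
move=> n0 [P xP] [Q nxQ].
have nK (k : nat) : (0 < k)%N -> k%:R != 0 :> K.
  by move: cK => /pcharf0P ->; rewrite -lt0n.
have pM0 := prim_order_gt0 wP; have p1 := prime_gt1 pp; have p0 := prime_gt0 pp.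
have M0 : (0 < M)%N by move: pM0; rewrite muln_gt0 => /andP[].
pose z := w ^+ M.
have zp : p.-primitive_root z.
  by have := dvdn_prim_root wP (dvdn_mulr M (dvdnn p)); rewrite mulKn.
pose h k := (P`_k)%:~R : K.
pose f i := \sum_(k < size P | (k %% p == i)%N) h k * w ^+ k.
pose W s := \sum_(i < p) f i * z ^+ (s * i).
have PW s : ev P (w * z ^+ s) = W s.
  rewrite evE /W (partition_big (fun k : 'I_(size P) => Ordinal (ltn_pmod k p0)) predT) //=.
  apply: eq_bigr => i _; rewrite /f mulr_suml; apply: eq_big => k; first by rewrite -val_eqE.
  move=> /eqP <- /=; rewrite exprMn -mulrA -exprM; congr (_ * (_ * _)).
  by apply/eqP; rewrite (eq_prim_root_expr zp) modnMmr.
(* Here [w ^+ (1 + M * s)] is again primitive and has the same p-th power as [w], so the relation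
   [n P(X) = Q(X^p)] at [w] also holds there. *)
have good s : ~~ (p %| 1 + M * s)%N -> n%:R * W s = ev Q (w ^+ p).
  move=> ps; pose t := (1 + M * s)%N.
  have wtP : (p * M).-primitive_root (w ^+ t).
    rewrite (prim_root_exp_coprime _ wP) coprimeMr [coprime t p]coprime_sym.
    by rewrite prime_coprime // ps /= /t /coprime gcdnC addnC mulnC gcdnMDl gcdn1.
  have evG (y : K) : ev (n%:Z *: P - (Q \Po 'X^p)) y = n%:R * ev P y - ev Q (y ^+ p).
    rewrite rmorphB hornerD hornerN /= map_polyZ hornerZ /=.
    by rewrite map_comp_poly /= map_polyXn horner_comp hornerXn.
  have := prim_root_conj cK cK wP wtP (p := n%:Z *: P - (Q \Po 'X^p)).
  rewrite !evG -xP nxQ subrr => /(_ erefl)/eqP; rewrite subr_eq0 => /eqP.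
  rewrite /t exprD expr1 exprM PW => ->; congr (ev Q _).
  by rewrite exprMn -!exprM mulnAC [(M * p)%N]mulnC exprM (prim_expr_order wP) expr1n mulr1.
have fourier (i : 'I_p) j : (p %| i + j)%N ->
    \sum_(s < p) z ^+ (s * j) * W s = p%:R * f i.
  move=> pij; under eq_bigr do rewrite mulr_sumr.
  rewrite exchange_big (bigD1 i) //= [X in _ + X]big1 ?addr0; last first.
    move=> k ki; under eq_bigr do rewrite mulrCA -exprD -mulnDr mulnC exprM.
    rewrite -mulr_sumr sum_unity ?mulr0 //.
      by rewrite exprAC (prim_expr_order zp) expr1n.
    rewrite -(prim_order_dvd zp); apply: contraNN ki => pjk.
    rewrite -val_eqE /= -[val k](modn_small (ltn_ord k)) -[val i](modn_small (ltn_ord i)).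
    by rewrite -(eqn_modDr j) addnC (eqP pjk) (eqP pij).
  rewrite (eq_bigr (fun _ => f i)); first by rewrite sumr_const card_ord mulr_natl.
  move=> s _; rewrite mulrCA -exprD -mulnDr addnC mulnC exprM.
  by move: pij; rewrite (prim_order_dvd zp) => /eqP ->; rewrite expr1n mulr1.
have f0P : int_adjoin (w ^+ p) (f 0).
  apply: int_adjoin_sum => k /eqP pk; apply: int_adjoinM; first exact: int_adjoin_int.
  by rewrite (divn_eq k p) pk addn0 mulnC exprM; apply: int_adjoinX.
(* Either every [s < p] is good, and Fourier inversion gives [x = f 0], or some [s0] is bad; it is
   then the only one, since [p] cannot divide [M]. *)
have [/existsP[s0 ps0]|] := boolP [exists s : 'I_p, (p %| 1 + M * s)%N]; last first.
  rewrite negb_exists => /forallP allgood.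
  suff -> : x = f 0 by [].
  apply: (mulfI (nK _ n0)); apply: (mulfI (nK _ p0)).
  have := fourier (Ordinal p0) 0%N (dvdn0 _) => /= E.
  rewrite [RHS]mulrCA -E mulr_sumr nxQ.
  rewrite (eq_bigr (fun _ => ev Q (w ^+ p))); first by rewrite sumr_const card_ord mulr_natl.
  by move=> s _; rewrite muln0 mul1r good.
have f1P : int_adjoin (w ^+ p) (f 1 * z ^+ s0).
  rewrite /f mulr_suml; apply: int_adjoin_sum => k /eqP pk.
  rewrite -mulrA -exprM -exprD; apply: int_adjoinM; first exact: int_adjoin_int.
  have /dvdnP[q ->] : (p %| k + M * s0)%N.
    by rewrite (divn_eq k p) pk -addnA dvdn_addr ?dvdn_mull.
  by rewrite mulnC exprM; apply: int_adjoinX.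
have pM : ~~ (p %| M)%N.
  apply/negP => pM; move: ps0; rewrite dvdn_addl ?dvdn_mulr // dvdn1 => /eqP pE.
  by rewrite pE in p1.
have s0good (s : 'I_p) : s != s0 -> n%:R * W s = ev Q (w ^+ p).
  move=> ss0; apply: good; apply: contraNN ss0 => ps; rewrite -val_eqE.
  have lem (a b : nat) : (b < p)%N -> (a <= b)%N -> (p %| 1 + M * a)%N ->
      (p %| 1 + M * b)%N -> a = b.
    move=> bp ab pa pb; have := dvdn_sub pb pa.
    rewrite subnDl -mulnBr Euclid_dvdM // (negPf pM) /= => pba.
    apply/eqP; rewrite eqn_leq ab /= -subn_eq0 -leqn0 leqNgt.
    apply/negP => ba0; have := dvdn_leq ba0 pba.
    by rewrite leqNgt (leq_ltn_trans (leq_subr _ _) bp).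
  have [ss0|/ltnW ss0] := leqP s s0; [|rewrite eq_sym]; apply/eqP;
    exact: lem (ltn_ord _) ss0 _ _.
(* The unknown value [n * W s0] occurs with the same coefficient in the inversions [E0] and [E1] and
   cancels in their difference, which is [p * B]. *)
suff -> : x = f 0 - f 1 * z ^+ s0.
  by apply: int_adjoinD => //; rewrite -mulN1r; apply: int_adjoinM => //; apply: (int_adjoin_int _ (-1)).
set B := ev Q _ in nxQ good s0good.
have E0 : p%:R * (n%:R * f 0) = n%:R * W s0 + p.-1%:R * B.
  have := fourier (Ordinal p0) 0%N (dvdn0 _) => /= E.
  rewrite mulrCA -E mulr_sumr (bigD1 s0) //= muln0 mul1r; congr (_ + _).
  rewrite (eq_bigr (fun _ => B)); last by move=> s ss0; rewrite muln0 mul1r s0good.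
  by rewrite sumr_const cardC1 card_ord mulr_natl.
have E1 : p%:R * (n%:R * (f 1 * z ^+ s0)) = n%:R * W s0 - B.
  have pE : (p %| 1 + p.-1)%N by rewrite add1n prednK.
  have := fourier (Ordinal p1) p.-1 pE => /= E.
  have zz : z ^+ (s0 * p.-1) * z ^+ s0 = 1.
    rewrite -exprD -mulnSr prednK // mulnC exprM (prim_expr_order zp) expr1n //.
  rewrite [LHS]mulrCA [p%:R * _]mulrA -E mulr_suml mulr_sumr.
  have -> : n%:R * W s0 - B = n%:R * W s0 + \sum_(s < p | s != s0) z ^+ (s * p.-1) * z ^+ s0 * B.
    congr (_ + _); rewrite -!mulr_suml.
    have : \sum_(s < p) z ^+ (s * p.-1) = 0.
      under eq_bigr do rewrite mulnC exprM.
      apply: sum_unity; first by rewrite exprAC (prim_expr_order zp) expr1n.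
      rewrite -(prim_order_dvd zp); apply/negP => /dvdn_leq.
      by rewrite -subn1 subn_gt0 p1 leqNgt ltn_subrL p0 => /(_ isT).
    rewrite (bigD1 s0) //= => /eqP; rewrite addrC addr_eq0 => /eqP ->.
    by rewrite !mulNr zz mul1r.
  rewrite (bigD1 s0) //=; congr (_ + _).
    by rewrite mulrAC zz mul1r.
  apply: eq_bigr => s ss0; rewrite -(s0good _ ss0) mulrCA mulrC !mulrA.
  by rewrite mulrAC mulrC !mulrA; congr (_ * _); exact: mulrAC.
apply: (mulfI (nK _ n0)); apply: (mulfI (nK _ p0)).
rewrite !mulrBr E0 E1 nxQ opprB addrC addrA subrK.
by rewrite -[in LHS](prednK p0) mulrS mulrDl mul1r.
Qed.

End PurityStep.

(** Induction on [m] by peeling off a prime [p]: as [Z[w^m]] lies in [Z[w^p]], the step puts [x] in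
    [Z[w^p]], and [w ^+ p] has order [e * (m / p)]. *)
Lemma int_adjoin_pure (K : fieldType) (e m n : nat) (w x : K) :
  [pchar K] =i pred0 -> (e * m).-primitive_root w -> (0 < n)%N ->
  int_adjoin w x -> int_adjoin (w ^+ m) (n%:R * x) -> int_adjoin (w ^+ m) x.
Proof.
move=> cK; elim/ltn_ind: m w => m IHm w wP n0 wx nx.
have [m1|] := leqP m 1.
  have := prim_order_gt0 wP; rewrite muln_gt0 => /andP[_ m0].
  have -> : m = 1%N by apply/eqP; rewrite eqn_leq m1.
  by rewrite expr1.
move=> m1; set p := pdiv m; have pp : prime p by exact: pdiv_prime.
have pm : (p * (m %/ p))%N = m by rewrite mulnC divnK // pdiv_dvd.
have wP' : (p * (e * (m %/ p))).-primitive_root w by rewrite mulnCA pm.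
have wmE : w ^+ m = (w ^+ p) ^+ (m %/ p) by rewrite -exprM pm.
rewrite wmE in nx *; apply: IHm => //.
- by rewrite ltn_Pdiv ?prime_gt1 // ltnW.
- have := dvdn_prim_root wP' (dvdn_mull p (dvdnn _)).
  rewrite mulnK //.
  by move: (prim_order_gt0 wP'); rewrite muln_gt0 => /andP[].
have wpx := int_adjoin_exp nx.
exact: (int_adjoin_pure_step cK pp wP' n0 wx wpx).
Qed.

Lemma int_adjoin_prim_root (K : fieldType) n (z z' x : K) :
  n.-primitive_root z -> n.-primitive_root z' ->
  int_adjoin z x -> int_adjoin z' x.
Proof.
move=> zP z'P; have [i ->] := prim_rootP z'P (prim_expr_order zP).
exact: int_adjoin_exp.
Qed.

End CyclotomicIntegers.

(** * Traces of operators with [T^(m+1) = T] *)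

Section FiniteOrderTrace.

Variables (K : fieldType) (V : vectType K) (T : 'End(V)) (m : nat) (w : K).
Hypotheses (cK : [pchar K] =i pred0) (wP : m.-primitive_root w).
Hypothesis Tm : forall v, iter m.+1 T v = T v.

(* [E i] projects onto the eigenspace of [T] for [w ^+ i]. *)
Let E (i : 'I_m) : 'End(V) :=
  m%:R^-1 *: \sum_(j < m) w ^+ (i * (m - j.+1)) *: linfun (iter j.+1 T).

(** [T^m] is the identity only on the image of [T], so the idempotents [E i] add up to [T^m] and not
    to 1. Still [T] is the sum of the [w ^+ i *: E i], and the trace of [E i] is its rank. *)
Lemma finite_order_trace : int_adjoin w (lfun_trace T).
Proof.
have m0 := prim_order_gt0 wP.
have mK : m%:R != 0 :> K by move: cK => /pcharf0P ->; rewrite -lt0n.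
have lT j : lin (iter j T) by elim: j => [|j IH] k x y; rewrite ?iterS ?IH ?linearP.
have EE i v : E i v = m%:R^-1 *: \sum_(j < m) w ^+ (i * (m - j.+1)) *: iter j.+1 T v.
  rewrite /E scale_lfunE sum_lfunE; congr (_ *: _); apply: eq_bigr => j _.
  by rewrite scale_lfunE lin_linfun.
have TE i v : T (E i v) = w ^+ i *: E i v.
  rewrite !EE linearZ /= scalerA mulrC -scalerA; congr (_ *: _).
  pose G j := w ^+ (i * (m - j)) *: iter j.+1 T v.
  have G0m : G 0%N = G m.
    rewrite /G Tm subnn muln0 subn0 mulnC exprM (prim_expr_order wP) expr1n.
    by rewrite scale1r.
  transitivity (\sum_(j < m) G j.+1).
    by rewrite linear_sum; apply: eq_bigr => j _; rewrite linearZ.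
  transitivity (\sum_(j < m) G j).
    have sG : \sum_(j < m.+1) G j = G 0%N + \sum_(j < m) G j.+1 by rewrite big_ord_recl.
    by apply: (addrI (G 0%N)); rewrite -sG big_ord_recr /= -G0m addrC.
  rewrite scaler_sumr; apply: eq_bigr => j _.
  rewrite scalerA -exprD -{1}(muln1 i) -mulnDr; congr (w ^+ (i * _) *: _).
  by rewrite add1n -subSn.
have iterTE i j v : iter j T (E i v) = w ^+ (i * j) *: E i v.
  elim: j => [|j IHj]; first by rewrite muln0 scale1r.
  by rewrite iterS IHj linearZ /= TE scalerA -exprD addnC mulnS.
have Eidem i v : E i (E i v) = E i v.
  rewrite {1}EE (eq_bigr (fun _ => E i v)).
    by rewrite sumr_const card_ord -scaler_nat scalerA mulVf ?scale1r.
  move=> j _; rewrite iterTE scalerA -exprD -mulnDr subnK // mulnC exprM.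
  by rewrite (prim_expr_order wP) expr1n scale1r.
have sumE v : \sum_i E i v = iter m T v.
  under eq_bigr do rewrite EE.
  rewrite -scaler_sumr exchange_big /=.
  have mP : (m.-1 < m)%N by rewrite ltn_predL.
  rewrite (bigD1 (Ordinal mP)) //= [X in _ + X]big1 ?addr0; last first.
    move=> j jm; rewrite -scaler_suml.
    under eq_bigr do rewrite mulnC exprM.
    rewrite sum_unity ?scale0r //; first by rewrite exprAC (prim_expr_order wP) expr1n.
    rewrite -(prim_order_dvd wP); apply: contraNN jm => mj.
    rewrite -val_eqE /=; have [//|jm] := eqVneq (val j) m.-1.
    have j0 : (0 < m - j.+1)%N.
      rewrite subn_gt0 ltn_neqAle ltn_ord andbT; apply: contraNneq jm => jm.
      by apply/eqP; exact: (congr1 predn jm).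
    have := dvdn_leq j0 mj.
    by rewrite leqNgt ltn_subrL m0.
  rewrite prednK // subnn; under eq_bigr do rewrite muln0 scale1r.
  rewrite sumr_const card_ord -scaler_nat scalerA mulVf // scale1r.
  by rewrite -[in RHS](prednK m0).
have Tsum v : T v = \sum_(i < m) w ^+ i *: E i v.
  by rewrite -Tm iterS -sumE linear_sum; apply: eq_bigr => i _; rewrite /= TE.
have -> : lfun_trace T = \sum_(i < m) w ^+ i * lfun_trace (E i).
  rewrite lfun_traceE; under eq_bigr do rewrite Tsum linear_sum.
  rewrite exchange_big; apply: eq_bigr => i _ /=.
  by rewrite lfun_traceE mulr_sumr; apply: eq_bigr => k _; rewrite linearZ.
apply: int_adjoin_sum => i _; apply: int_adjoinM; first exact: int_adjoinX.
by rewrite (trace_idem (Eidem i)); apply: (int_adjoin_int w (Posz _)).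
Qed.

End FiniteOrderTrace.

(** * Nonvanishing of certain sums of roots of unity *)

Section RootSums.

Import Order.TTheory Num.Theory.

Variables (F : closedFieldType) (I : finType) (e : rel I) (al : I -> F) (N : nat).
Hypotheses (cF : [pchar F] =i pred0) (N0 : (0 < N)%N).
Hypotheses (eR : reflexive e) (eS : symmetric e) (eT : transitive e).
Hypotheses (al0 : forall i, al i != 0).
Hypothesis (alN : forall i j, e i j -> (al j / al i) ^+ N = 1).

(* Rescaling [al] on each class by a class representative turns it into      *)
(* roots of unity [w ^+ k i], so that the sum below becomes the sum over the *)
(* classes of [`|\sum_i w ^+ k i| ^+ 2] when computed in [algC].             *)
Lemma sum_ratio_neq0 (i0 : I) : (forall j, e i0 j -> j = i0) ->
  \sum_i \sum_(j | e i j) al j / al i != 0.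
Proof.
move=> e0; pose rep i := odflt i [pick j | e i j].
have erep i : e i (rep i).
  by rewrite /rep; case: pickP => //= _; apply: eR.
have repE i j : e i j = (rep i == rep j).
  apply/idP/eqP => [eij|rij]; last first.
    by apply: eT (erep i) _; rewrite rij eS.
  have E : e i =1 e j by move=> k; apply/idP/idP; apply: eT; rewrite // eS.
  rewrite /rep (eq_pick E); case: pickP => //= /(_ j).
  by rewrite eR.
have [w wP] := closed_prim_root cF N0; have [z zP] := C_prim_root_exists N0.
have rootk i : exists k : 'I_N, al i / al (rep i) = w ^+ k.
  have /(alN)/(prim_rootP wP)[k kE] : e (rep i) i by rewrite eS.
  by exists k.
have [k kP] := fin_all_exists rootk.
(* The exponent [N - k i] replaces [- k i], giving an integer polynomial that can be evaluated both
   in [F] and in [algC]. *)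
pose P : {poly int} := \sum_i \sum_(j | e i j) 'X^(k j + (N - k i)).
have evP (K : fieldType) (x : K) :
    (map_poly intr P).[x] = \sum_i \sum_(j | e i j) x ^+ (k j + (N - k i)).
  rewrite rmorph_sum horner_sum; apply: eq_bigr => i _ /=.
  rewrite rmorph_sum horner_sum; apply: eq_bigr => j _ /=.
  by rewrite map_polyXn hornerXn.
have wE : \sum_i \sum_(j | e i j) al j / al i = (map_poly intr P).[w].
  rewrite evP; apply: eq_bigr => i _; apply: eq_bigr => j eij.
  rewrite exprD expfB //.
  rewrite (prim_expr_order wP) -!kP div1r invf_div.
  have -> : rep j = rep i by apply/esym/eqP; rewrite -repE.
  by rewrite mulrA divfK.
have cC : [pchar algC] =i pred0 by apply/pcharf0P => n; rewrite pnatr_eq0.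
rewrite wE; apply/eqP => /(prim_root_conj cF cC wP zP); apply/eqP.
rewrite evP; pose c i := \sum_(j | rep j == i) z ^+ k j.
have normz i : `|z ^+ i| = 1.
  have z1 : `|z| = 1.
    apply/eqP; rewrite -(pexpr_eq1 N0) ?normr_ge0 // -normrX.
    by rewrite (prim_expr_order zP) normr1.
  by rewrite normrX z1 expr1n.
have conjz i : (i < N)%N -> z ^+ (N - i) = (z ^+ i)^*%R.
  move=> iN; rewrite expfB // (prim_expr_order zP) div1r.
  have zi0 : z ^+ i != 0 by rewrite -normr_eq0 normz oner_eq0.
  by apply: (mulfI zi0); rewrite divff // -normCK normz expr1n.
(* When [i] is not a class representative, [c i] is an empty sum. *)
have -> : \sum_i \sum_(j | e i j) z ^+ (k j + (N - k i)) = \sum_i `|c i| ^+ 2.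
  rewrite (partition_big rep predT) //=; apply: eq_bigr => i _.
  rewrite normCK /c rmorph_sum mulr_sumr; apply: eq_bigr => j /eqP ji.
  rewrite mulr_suml; apply: eq_big => [l|l _]; first by rewrite repE ji eq_sym.
  by rewrite exprD conjz.
have rep0 : rep i0 = i0 by apply: e0.
have c0 : c i0 = z ^+ k i0.
  rewrite /c (big_pred1 i0) // => j; apply/eqP/eqP => [rj|-> //].
  by apply: e0; rewrite repE rep0 rj.
rewrite (bigD1 i0) //= c0 normz expr1n gt_eqF // ltr_wpDr ?ltr01 //.
by apply: sumr_ge0 => i _; apply: exprn_ge0; apply: normr_ge0.
Qed.

End RootSums.

(** * Idempotents of semisimple algebras *)

Section SemisimpleAlgebra.

Variables (F : closedFieldType) (H : falgType F).
Hypotheses (cF : [pchar F] =i pred0) (ssH : semisimple_algebra H).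

Lemma limg_amulrP (k x : H) : reflect (exists h, x = h * k) (x \in limg (amulr k)).
Proof.
apply: (iffP memv_imgP) => [[h _ ->]|[h ->]]; exists h; rewrite ?memvf ?lfunE //.
Qed.

(** Write [1 = e + f] along [H k] and a complement [J]. Then [k f = k - k e] lies in both, so
    [k = k e], and [e] has the form [h k]. *)
Lemma von_neumann_regular (k : H) : exists h, k * (h * k) = k.
Proof.
pose I := limg (amulr k).
have lI : left_ideal I.
  apply/prodvP => u v _ /limg_amulrP[h ->]; apply/limg_amulrP.
  by exists (u * h); rewrite mulrA.
have [J [lJ IJ IJ0]] := ssH lI.
have : 1 \in (I + J)%VS by rewrite IJ memvf.
case/memv_addP => e eI [f fJ ef].
have [h eE] := limg_amulrP _ _ eI; exists h; rewrite -eE.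
have kI : k \in I by apply/limg_amulrP; exists 1; rewrite mul1r.
have kfI : k * f \in I.
  have -> : k * f = k - k * e by rewrite -{2}[k]mulr1 ef mulrDr addrC addKr.
  apply: memvB => //; move/prodvP: lI; apply => //; exact: memvf.
have kfJ : k * f \in J by move/prodvP: lJ; apply => //; exact: memvf.
have : k * f \in (I :&: J)%VS by rewrite memv_cap kfI.
by rewrite IJ0 memv0 -{3}[k]mulr1 ef mulrDr => /eqP ->; rewrite addr0.
Qed.

Section FiniteOrder.

Variables (phi : 'End(H)) (N : nat).
Hypotheses (phiM : forall a b, phi (a * b) = phi a * phi b) (phi1 : phi 1 = 1).
Hypotheses (N0 : (0 < N)%N) (phiN : forall h, iter N phi h = h).

(** Start from [e = h0 k] with [k e = k]. Every [phi^j e] has this property too because [phi] fixes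
    [k], hence so does their average, which [phi] fixes. *)
Lemma idem_gen (k : H) : phi k = k ->
  exists h, [/\ h * k * (h * k) = h * k, k * (h * k) = k & phi (h * k) = h * k].
Proof.
move=> phik; have [h0 ke] := von_neumann_regular k.
set e := h0 * k in ke.
have itM j a b : iter j phi (a * b) = iter j phi a * iter j phi b.
  by elim: j => //= j ->; rewrite phiM.
have itk j : iter j phi k = k by elim: j => //= j ->.
pose h := N%:R^-1 *: \sum_(j < N) iter j phi h0.
have hkE : h * k = N%:R^-1 *: \sum_(j < N) iter j phi e.
  rewrite -scalerAl mulr_suml; congr (_ *: _); apply: eq_bigr => j _.
  by rewrite /e itM itk.
have NF : N%:R != 0 :> F by move: cF => /pcharf0P ->; rewrite -lt0n.
have khk : k * (h * k) = k.
  rewrite hkE -scalerAr mulr_sumr (eq_bigr (fun _ => k)).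
    by rewrite sumr_const card_ord -scaler_nat scalerA mulVf ?scale1r.
  by move=> j _; rewrite -{1}(itk j) -itM ke itk.
exists h; split => //; first by rewrite -mulrA khk.
rewrite hkE linearZ /= linear_sum; congr (_ *: _).
have E : \sum_(j < N.+1) iter j phi e = e + \sum_(j < N) iter j.+1 phi e.
  by rewrite big_ord_recl.
by apply: (addrI e); rewrite -E big_ord_recr /= phiN addrC.
Qed.

(** A split polynomial annihilates [b], so a product of factors [b - mu] kills [f]. Dropping factors
    from the left until the product with [f] is nonzero yields [v]; the factors commute with [f]. *)
Lemma idem_eigen (b f : H) : f != 0 -> f * f = f -> b * f = b -> f * b = b ->
  exists mu v, [/\ v != 0, f * v = v & b * v = mu *: v].
Proof.
move=> f0 ff bf fb.
pose n := \dim {:H}; pose ev (c : 'rV[F]_n.+1) := \sum_i c 0 i *: b ^+ i.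
have lev : lin ev.
  move=> k x y; rewrite /ev scaler_sumr -big_split; apply: eq_bigr => i _ /=.
  by rewrite !mxE scalerDl scalerA.
have [c c0 evc] : exists2 c, c != 0 & ev c = 0.
  have : lker (linfun ev) != 0%VS.
    apply/negP => /eqP ker0; have := limg_ker_dim (linfun ev) fullv.
    rewrite ker0 capv0 dimv0 add0n dimvf /dim /= mul1n => E.
    by have := dimvS (subvf (limg (linfun ev))); rewrite E ltnn.
  move=> ker0; exists (vpick (lker (linfun ev))); first by rewrite vpick0.
  by have := memv_pick (lker (linfun ev)); rewrite memv_ker lin_linfun // => /eqP.
pose P := \poly_(i < n.+1) c 0 (inord i).
have P0 : P != 0.
  apply: contraNneq c0 => P0; apply/eqP/rowP => i; rewrite mxE.
  by have := congr1 (fun q : {poly F} => q`_i) P0; rewrite /P coef_poly coef0 ltn_ord inord_val.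
have hP : horner_alg b P = 0.
  rewrite /P poly_def linear_sum -[RHS]evc; apply: eq_bigr => i _ /=.
  by rewrite linearZ /= rmorphXn /= horner_algX inord_val mulr_algl.
have [rs PE] := closed_field_poly_normal P.
have prod0 : (\prod_(mu <- rs) (b - mu%:A)) * f = 0.
  have -> : \prod_(mu <- rs) (b - mu%:A) = horner_alg b (\prod_(mu <- rs) ('X - mu%:P)).
    rewrite rmorph_prod; apply: eq_bigr => mu _.
    by rewrite rmorphB /= horner_algX horner_algC.
  move: hP; rewrite PE linearZ /= mulr_algl => /eqP; rewrite scaler_eq0 lead_coef_eq0 (negPf P0) /=.
  by move/eqP ->; rewrite mul0r.
elim: rs {PE} prod0 => [|mu rs IHrs]; first by rewrite big_nil mul1r => fE; rewrite fE eqxx in f0.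
rewrite big_cons -mulrA; set v := _ * f => bv.
have [v0|v0] := eqVneq v 0; first exact: IHrs.
exists mu, v; split=> //; last first.
  by move/eqP: bv; rewrite mulrBl subr_eq0 mulr_algl => /eqP.
rewrite /v; elim: rs {IHrs v bv v0} => [|nu rs IH]; first by rewrite big_nil mul1r.
have comm : f * (b - nu%:A) = (b - nu%:A) * f.
  by rewrite mulrBr mulrBl fb bf mulr_algl mulr_algr.
by rewrite big_cons -mulrA mulrA comm -mulrA IH.
Qed.

(** Primitivity is meant in the subalgebra fixed by [phi]: the last clause says that its corner at
    [p i] consists of multiples of [p i]. *)
Definition fixed_primitive_family (I : finType) (p : I -> H) (f : H) : Prop :=
  [/\ \sum_i p i = f, forall i j, p i * p j = if i == j then p i else 0,
      forall i, p i != 0, forall i, phi (p i) = p i &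
      forall i y, phi y = y -> exists c : F, p i * y * p i = c *: p i].

(** Induction on [dim H f]. If some fixed [b0 = f y f] is not a multiple of [f], subtract an
    eigenvalue to get a fixed [c <> 0] that kills some [v <> 0] with [f v = v]. The fixed idempotent
    [e] generating [H c] splits [f] into [f e], nonzero as [c e = c], and [f - f e], nonzero as
    [e v = 0]. *)
Lemma fixed_primitive_decomp (f : H) : f * f = f -> phi f = f ->
  exists (I : finType) (p : I -> H), fixed_primitive_family p f.
Proof.
have [n] := ubnP (\dim (limg (amulr f))); elim: n f => // n IHn f fn ff phif.
have [f0|f0] := eqVneq f 0.
  exists void, (fun _ => 0); split=> [|[]|[]|[]|[]] //.
  by rewrite big_pred0 ?f0 // => -[].
pose fix_sp := lker (phi - \1)%VF.
have fixP y : reflect (phi y = y) (y \in fix_sp).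
  by rewrite memv_ker add_lfunE opp_lfunE id_lfunE subr_eq0; apply: eqP.
pose cut := linfun (fun y => f * y * f).
have lcut : lin (fun y => f * y * f) by apply: lin_mulr; apply: lin_mull; apply: lin_id.
have [small|] := boolP (cut @: fix_sp <= <[f]>)%VS.
  exists unit, (fun _ => f); split=> //.
  - by rewrite big_const card_unit /= addr0.
  move=> _ y /fixP yfix; apply/vlineP; apply: (subvP small).
  by apply/memv_imgP; exists y => //; rewrite lin_linfun.
case/subvPn => b /memv_imgP[y /fixP yfix ->]; rewrite lin_linfun //.
set b0 := f * y * f => bf.
have bfE : b0 * f = b0 by rewrite /b0 -mulrA ff.
have fbE : f * b0 = b0 by rewrite /b0 !mulrA ff.
have [mu [v [v0 fv bv]]] := idem_eigen f0 ff bfE fbE.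
pose c := b0 - mu *: f.
have cf : c * f = c by rewrite mulrBl bfE -scalerAl ff.
have fc : f * c = c by rewrite mulrBr fbE -scalerAr ff.
have cv : c * v = 0 by rewrite mulrBl bv -scalerAl fv subrr.
have c0 : c != 0.
  by apply: contraNneq bf => /eqP; rewrite subr_eq0 => /eqP ->; rewrite memvZ ?memv_line.
have phic : phi c = c by rewrite linearB linearZ /= !phiM phif yfix.
have [h []] := idem_gen phic; set e := h * c => ee ce phie.
have ef : e * f = e by rewrite /e -mulrA cf.
pose f1 := f * e; pose f2 := f - f1.
have f1f1 : f1 * f1 = f1 by rewrite /f1 mulrA -[_ * e * f]mulrA ef -mulrA ee.
have ff1 : f * f1 = f1 by rewrite /f1 mulrA ff.
have f1f : f1 * f = f1 by rewrite /f1 -mulrA ef.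
have f1f2 : f1 * f2 = 0 by rewrite mulrBr f1f f1f1 subrr.
have f2f1 : f2 * f1 = 0 by rewrite mulrBl ff1 f1f1 subrr.
have f2f2 : f2 * f2 = f2 by rewrite {1}/f2 mulrBl f1f2 subr0 /f2 mulrBr ff ff1.
have phif1 : phi f1 = f1 by rewrite phiM phif phie.
have phif2 : phi f2 = f2 by rewrite linearB /= phif phif1.
have f10 : f1 != 0.
  by apply: contraNneq c0 => f1E; rewrite -ce -cf -mulrA -/f1 f1E mulr0.
have f20 : f2 != 0.
  apply: contraNneq v0 => /eqP; rewrite subr_eq0 => /eqP fE.
  by rewrite -fv fE /f1 /e -!mulrA cv !mulr0.
have shrink g g' : g * g = g -> g' != 0 -> f * g = g -> g * f = g -> g * g' = 0 ->
    f * g' = g' -> g' * f = g' -> g' * g' = g' ->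
    (\dim (limg (amulr g)) < \dim (limg (amulr f)))%N.
  move=> gg g'0 fg gf gg' fg' g'f g'g'.
  have sub : (limg (amulr g) <= limg (amulr f))%VS.
    apply/subvP => x /limg_amulrP[k ->]; apply/limg_amulrP.
    by exists (k * g); rewrite -mulrA gf.
  rewrite ltn_neqAle dimvS // andbT; apply: contraNN g'0 => dimE.
  have /eqP E : limg (amulr g) == limg (amulr f) by rewrite eqEdim sub (eqP dimE) /=.
  have : f \in limg (amulr g) by rewrite E; apply/limg_amulrP; exists f.
  case/limg_amulrP => k fE.
  by rewrite -fg' {1}fE -mulrA gg' mulr0.
have f2f : f2 * f = f2 by rewrite mulrBl ff f1f.
have ff2 : f * f2 = f2 by rewrite mulrBr ff ff1.
have n1 : (\dim (limg (amulr f1)) < n)%N.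
  by apply: leq_trans (shrink f1 f2 _ _ _ _ _ _ _ _) _.
have n2 : (\dim (limg (amulr f2)) < n)%N.
  by apply: leq_trans (shrink f2 f1 _ _ _ _ _ _ _ _) _.
have [I [p [sp op np fp pp]]] := IHn f1 n1 f1f1 phif1.
have [J [q [sq oq nq fq pq]]] := IHn f2 n2 f2f2 phif2.
have absorb (K : finType) (r : K -> H) g : \sum_i r i = g ->
    (forall i j, r i * r j = if i == j then r i else 0) ->
    forall i, r i * g = r i /\ g * r i = r i.
  move=> <- orth i; split.
    rewrite mulr_sumr (bigD1 i) //= orth eqxx big1 ?addr0 // => j ji.
    by rewrite orth eq_sym (negPf ji).
  rewrite mulr_suml (bigD1 i) //= orth eqxx big1 ?addr0 // => j ji.
  by rewrite orth (negPf ji).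
have ap := absorb _ _ _ sp op; have aq := absorb _ _ _ sq oq.
exists (I + J)%type, (fun k => match k with inl i => p i | inr j => q j end).
split.
- by rewrite big_sumType /= sp sq addrC subrK.
- move=> [i|i] [j|j] //=.
    by rewrite -(ap i).1 -(aq j).2 mulrA -[_ * f1 * f2]mulrA f1f2 mulr0 mul0r.
  by rewrite -(aq i).1 -(ap j).2 mulrA -[_ * f2 * f1]mulrA f2f1 mulr0 mul0r.
- by case.
- by case.
by case.
Qed.


(** As [phi] is conjugation by [a], it acts on [p i H p j] by the scalar [al j / al i]. These blocks
    have dimension 0 or 1, and being nonzero is an equivalence relation on indices, so the trace is
    the sum treated in [sum_ratio_neq0]. *)
Lemma trace_inner_neq0 (a : H) (eps : {scalar H}) :
  (forall h, a * phi h = h * a) -> (forall h, h * a = 0 -> h = 0) ->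
  eps 1 = 1 -> (forall x y, eps (x * y) = eps x * eps y) ->
  lfun_trace phi != 0.
Proof.
move=> aphi areg eps1 epsM.
have [b ba] : exists b, b * a = 1.
  suff : 1 \in limg (amulr a) by case/limg_amulrP => b ->; exists b.
  suff -> : limg (amulr a) = fullv by rewrite memvf.
  apply/eqP; rewrite eqEdim subvf /=.
  have := limg_ker_dim (amulr a) fullv.
  suff -> : (fullv :&: lker (amulr a) = 0)%VS by rewrite dimv0 add0n => ->.
  apply/eqP; rewrite -subv0; apply/subvP => h; rewrite memv_cap memv_ker lfunE /=.
  by rewrite memv0 => /andP[_ /eqP/areg/eqP].
have phia : phi a = a.
  by rewrite -[LHS]mul1r -ba -mulrA aphi mulrA ba mul1r.
have [I [p [sp op np fp pp]]] := fixed_primitive_decomp (mulr1 1) phi1.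
have pidem i : p i * p i = p i by rewrite op eqxx.
have ap i : a * p i = p i * a by rewrite -{1}fp aphi.
have [al alP] := fin_all_exists (fun i => pp i a phia).
have alE i : p i * a = al i *: p i by rewrite -alP -mulrA ap mulrA pidem.
have al0 i : al i != 0.
  apply: contraNneq (np i) => ai0; apply/eqP/areg.
  by rewrite alE ai0 scale0r.
have phiE i j h : phi (p i * h * p j) = (al j / al i) *: (p i * h * p j).
  have : a * phi (p i * h * p j) = al i *: phi (p i * h * p j).
    by rewrite !phiM !fp !mulrA ap alE -!scalerAl.
  rewrite aphi -(mulrA (p i * h)) alE -scalerAr => E.
  by apply: (scalerI (al0 i)); rewrite -E scalerA mulrCA divff // mulr1.
(* For [i = j] the scalar is 1: [phi] fixes the corner [p i H p i], so [p i] is primitive in [H]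
   itself. *)
have prim i h : exists c : F, p i * h * p i = c *: p i.
  have [|c cE] := pp i (p i * h * p i); first by rewrite phiE divff // scale1r.
  by exists c; rewrite -cE !mulrA pidem -!mulrA pidem.
pose V i j := linfun (fun h => p i * h * p j).
have VE i j h : V i j h = p i * h * p j.
  by rewrite lin_linfun //; apply: lin_mulr; apply: lin_mull; apply: lin_id.
have Vim i j x : reflect (p i * x * p j = x) (x \in limg (V i j)).
  apply: (iffP memv_imgP) => [[h _ ->]|xE]; last by exists x; rewrite ?memvf // VE.
  by rewrite VE !mulrA pidem -!mulrA pidem.
pose e i j := limg (V i j) != 0%VS.
have eP i j : reflect (exists2 x, x != 0 & p i * x * p j = x) (e i j).
  apply: (iffP idP) => [ij|[x x0 xE]].
    exists (vpick (limg (V i j))); first by rewrite vpick0.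
    by apply/Vim; apply: memv_pick.
  by apply: contraNneq x0 => V0; rewrite -memv0 -V0; apply/Vim.
(* A nonzero [x] in [p i H p j] is an isomorphism between the modules [H p i] and [H p j]; [y] is
   its inverse. *)
have quasi i j x : x != 0 -> p i * x * p j = x ->
    exists y, [/\ x * y = p i, y * x = p j & p j * y * p i = y].
  move=> x0 xE; have [h xhx] := von_neumann_regular x.
  pose y := p j * h * p i.
  have yE : p j * y * p i = y by rewrite /y !mulrA pidem -!mulrA pidem.
  have xp : x * p j = x by rewrite -xE -!mulrA pidem.
  have px : p i * x = x by rewrite -xE !mulrA pidem.
  have xyx : x * y * x = x.
    by rewrite /y !mulrA xp -!mulrA px.
  have [c cE] := prim i (x * h); have [d dE] := prim j (h * x).
  have xyE : x * y = c *: p i.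
    by rewrite -cE /y !mulrA xp px.
  have yxE : y * x = d *: p j.
    by rewrite -dE /y -!mulrA px xp.
  have c1 : c = 1.
    apply/eqP; rewrite -subr_eq0; apply: contraTT (x0) => c1; rewrite negbK.
    have : (c - 1) *: x == 0 by rewrite scalerBl scale1r -{1}px scalerAl -xyE xyx subrr.
    by rewrite scaler_eq0 (negPf c1).
  have d1 : d = 1.
    apply/eqP; rewrite -subr_eq0; apply: contraTT (x0) => d1; rewrite negbK.
    have : (d - 1) *: x == 0.
      by rewrite scalerBl scale1r -{1}xp scalerAr -yxE mulrA xyx subrr.
    by rewrite scaler_eq0 (negPf d1).
  by exists y; rewrite xyE yxE c1 d1 !scale1r.
have eR : reflexive e.
  by move=> i; apply/eP; exists (p i); rewrite ?np // !pidem.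
have eS' i j : e i j -> e j i.
  case/eP => x x0 xE; have [y [xy yx yE]] := quasi i j x x0 xE.
  apply/eP; exists y => //; apply: contraNneq (np i) => y0.
  by rewrite -xy y0 mulr0.
have eS : symmetric e by move=> i j; apply/idP/idP; apply: eS'.
have eT : transitive e.
  move=> j i k /eP[x x0 xE] /eP[x' x'0 x'E].
  have [y [xy yx yE]] := quasi i j x x0 xE.
  apply/eP; exists (x * x').
    apply: contraNneq x'0 => xx'; have pjx : p j * x' = 0 by rewrite -yx -mulrA xx' mulr0.
    by rewrite -x'E pjx mul0r.
  have px : p i * x = x by rewrite -xE !mulrA pidem.
  have xp' : x' * p k = x' by rewrite -x'E -!mulrA pidem.
  by rewrite mulrA px -mulrA xp'.
have alN i j : e i j -> (al j / al i) ^+ N = 1.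
  case/eP => x x0 xE; have xphi n : iter n phi x = (al j / al i) ^+ n *: x.
    elim: n => [|n IHn]; first by rewrite scale1r.
    by rewrite iterS IHn linearZ /= -xE phiE xE scalerA exprSr.
  have /eqP : ((al j / al i) ^+ N - 1) *: x = 0.
    by rewrite scalerBl -xphi phiN scale1r subrr.
  by rewrite scaler_eq0 (negPf x0) orbF subr_eq0 => /eqP.
have dimV i j : \dim (limg (V i j)) = e i j.
  case: (boolP (e i j)) => [/eP[x x0 xE]|]; last by rewrite negbK => /eqP ->; rewrite dimv0.
  have -> : limg (V i j) = <[x]>%VS; last by rewrite dim_vline x0.
  apply/eqP; rewrite eqEsubv; apply/andP; split; last by rewrite -memvE; apply/Vim.
  apply/subvP => x' /Vim x'E; apply/vlineP.
  have [y [xy yx yE]] := quasi i j x x0 xE; have [c cE] := prim j (y * x').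
  have px : p i * x' = x' by rewrite -x'E !mulrA pidem.
  have xp : x' * p j = x' by rewrite -x'E -!mulrA pidem.
  have xp' : x * p j = x by rewrite -xE -!mulrA pidem.
  have py : p j * y = y by rewrite -yE !mulrA pidem.
  exists c; rewrite -{1}px -{1}xy -mulrA -{1}xp' -[x in RHS]xp' scalerAr -cE !mulrA.
  by rewrite -[_ * x' * _]mulrA xp.
have tr : lfun_trace phi = \sum_i \sum_(j | e i j) al j / al i.
  have phiV h : phi h = \sum_i \sum_j (al j / al i) *: V i j h.
    rewrite -[h in LHS]mulr1 -[h in LHS]mul1r -{1}sp mulr_suml mulr_suml linear_sum.
    apply: eq_bigr => i _; rewrite -sp mulr_sumr linear_sum; apply: eq_bigr => j _ /=.
    by rewrite phiE VE.
  rewrite lfun_traceE; under eq_bigr do rewrite phiV linear_sum.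
  rewrite exchange_big; apply: eq_bigr => i _ /=.
  under eq_bigr do rewrite linear_sum.
  rewrite exchange_big [RHS]big_mkcond; apply: eq_bigr => j _ /=.
  under eq_bigr do rewrite linearZ.
  rewrite -mulr_sumr -lfun_traceE trace_idem; last first.
    by move=> h; rewrite !VE !mulrA pidem -!mulrA pidem.
  by rewrite dimV; case: (e i j); rewrite ?mulr1 ?mulr0.
(* The trivial module supplies the singleton class: [eps] is nonzero on the whole class of [i0], yet
   [p i0 p j = 0] for [j <> i0]. *)
have [i0 epsi0] : exists i, eps (p i) != 0.
  apply/existsP; apply: contra_eqT (eps1) => /existsPn no; rewrite -sp linear_sum /=.
  rewrite big1 ?[0 == 1]eq_sym ?oner_eq0 // => i _.
  by apply/eqP; have := no i; rewrite negbK.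
rewrite tr; apply: (sum_ratio_neq0 cF N0 eR eS eT al0 alN (i0 := i0)) => j.
case/eP => x x0 xE; have [y [xy yx yE]] := quasi i0 j x x0 xE.
have epsx : eps x != 0.
  by apply: contraNneq epsi0 => epsx0; rewrite -xy epsM epsx0 mul0r.
have epsj : eps (p j) != 0.
  by apply: contraNneq epsx => epsj0; rewrite -xE epsM epsj0 mulr0.
have := epsM (p i0) (p j); rewrite op; have [-> //|ij /esym/eqP] := eqVneq i0 j.
by rewrite linear0 mulf_eq0 (negPf epsi0) (negPf epsj).
Qed.

End FiniteOrder.
End SemisimpleAlgebra.

(** * Integrals and the antipode *)

Section SweedlerCalculus.

Variables (F : fieldType) (H : falgType F) (A : hopf_algebra H).
Implicit Types (W : vectType F) (h k : H).

Local Notation Delta := (comul A).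
Local Notation eps := (counit A).
Local Notation S := (antipode A).
(* Sweedler notation: [\sw_(a, b <- h) E a b] is \sum E(h_1, h_2); it has its  *)
(* expected meaning only for bilinear [E].                                   *)
Local Notation "'\sw_' ( a , b '<-' h ) E" :=
  (@tlift F H H _ (fun a b => E) (Delta h))
  (at level 36, a name, b name, h at level 50, E at level 36).

Lemma swA W (f : H -> H -> H -> W) h :
  (forall b c, lin (fun a => f a b c)) -> (forall a c, lin (fun b => f a b c)) ->
  (forall a b, lin (fun c => f a b c)) ->
  \sw_(x, y <- h) \sw_(a, b <- x) f a b y =
  \sw_(x, y <- h) \sw_(a, b <- y) f x a b.
Proof.
move=> l1 l2 l3.
have bf a : bilin (f a) by split.
pose G := tlift (fun (a : H) (t : tensor H H) => tlift (f a) t).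
have lG : lin G by exact: tliftP.
have := congr1 G (comulA A h); rewrite /tassoc.
rewrite [in RHS]/G [in RHS]tlift_tmap; last by lin_tac.
move=> <-; rewrite (lin_tliftE _ _ lG).
rewrite tlift_tmap; last first.
  split=> c; last by apply: (lin_comp lG); lin_tac.
  by apply: (lin_comp lG); lin_tac.
sw_ext => x y; rewrite (lin_tliftE _ _ lG).
sw_ext => a b; rewrite /G tlift_tens; last by lin_tac.
by rewrite tlift_tens.
Qed.

Lemma swM W (f : H -> H -> W) h k : bilin f ->
  \sw_(a, b <- h * k) f a b =
  \sw_(a, b <- h) \sw_(c, d <- k) f (a * c) (b * d).
Proof.
move=> bf; have lf : lin (tlift f) by exact: tliftP.
rewrite comulM /tmul (lin_tliftE _ _ lf); sw_ext => a b.
rewrite (lin_tliftE _ _ lf); sw_ext => c d.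
by rewrite tlift_tens.
Qed.

Lemma sw1 W (f : H -> H -> W) : bilin f -> \sw_(a, b <- 1) f a b = f 1 1.
Proof. by move=> bf; rewrite comul1 tlift_tens. Qed.

Lemma sw_epsl W (f : H -> W) h : lin f -> \sw_(a, b <- h) (eps a *: f b) = f h.
Proof.
move=> lf; rewrite -[in RHS](counitl A h) (lin_tliftE _ _ lf).
by sw_ext => a b; rewrite (linZ _ _ lf).
Qed.

Lemma sw_epsr W (f : H -> W) h : lin f -> \sw_(a, b <- h) (eps b *: f a) = f h.
Proof.
move=> lf; rewrite -[in RHS](counitr A h) (lin_tliftE _ _ lf).
by sw_ext => a b; rewrite (linZ _ _ lf).
Qed.

Lemma sw_antil W (f : H -> W) h : lin f ->
  \sw_(a, b <- h) f (S a * b) = eps h *: f 1.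
Proof.
by move=> lf; rewrite -(linZ _ _ lf) -(antipodel A h) (lin_tliftE _ _ lf).
Qed.

Lemma sw_antir W (f : H -> W) h : lin f ->
  \sw_(a, b <- h) f (a * S b) = eps h *: f 1.
Proof.
by move=> lf; rewrite -(linZ _ _ lf) -(antipoder A h) (lin_tliftE _ _ lf).
Qed.

Lemma functional_ext h k : (forall p : 'Hom(H, F^o), p h = p k) -> h = k.
Proof.
move=> pp; rewrite (coord_vbasis (memvf h)) (coord_vbasis (memvf k)).
apply: eq_bigr => i _; congr (_ *: _).
have lc : lin (fun x => coord (vbasis {:H}) i x : F^o).
  by move=> c x y; rewrite linearP.
by have := pp (linfun (fun x => coord (vbasis {:H}) i x : F^o));
  rewrite !(lin_linfun lc).
Qed.

Section Integral.

Variables (L : H).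
Hypothesis intL : normalized_integral A L.

Let hL h : h * L = eps h *: L. Proof. by case: intL. Qed.
Let Lh h : L * h = eps h *: L. Proof. by case: intL. Qed.
Let epsL : eps L = 1. Proof. by case: intL. Qed.

(** Both sides equal [S(h_1) h_2 L_1 (x) h_3 L_2]: either [S(h_1) h_2] collapses, or [L] absorbs
    [h_2 (x) h_3]. *)
Lemma sw_int_movel W (f : H -> H -> W) h : bilin f ->
  \sw_(a, b <- L) f a (h * b) = \sw_(a, b <- L) f (S h * a) b.
Proof.
move=> bf.
transitivity (\sw_(x, y <- h) \sw_(a, b <- y * L) f (S x * a) b); last first.
  rewrite -(sw_epsr (f := fun x => \sw_(a, b <- L) f (S x * a) b)); last by lin_tac.
  by sw_ext => x y; rewrite hL linearZ /= (linZ _ _ (@tliftP _ _ _ _ _)).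
transitivity (\sw_(x, y <- h) \sw_(c, d <- y) \sw_(a, b <- L)
  f (S x * (c * a)) (d * b)); last first.
  by sw_ext => x y; rewrite swM //; lin_tac.
rewrite -(swA (f := fun x c d => \sw_(a, b <- L) f (S x * (c * a)) (d * b))); [|lin_tac..].
rewrite -(sw_epsl (f := fun y => \sw_(a, b <- L) f a (y * b))); last by lin_tac.
sw_ext => x y.
have -> : \sw_(a, b <- L) f a (y * b) = \sw_(a, b <- L) f (1 * a) (y * b).
  by sw_ext => a b; rewrite mul1r.
rewrite -(sw_antil (f := fun z => \sw_(a, b <- L) f (z * a) (y * b))); last by lin_tac.
by sw_ext => c d; sw_ext => a b; rewrite mulrA.
Qed.

Lemma sw_int_mover W (f : H -> H -> W) h : bilin f ->
  \sw_(a, b <- L) f (a * h) b = \sw_(a, b <- L) f a (b * S h).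
Proof.
move=> bf.
transitivity (\sw_(x, y <- h) \sw_(a, b <- L * x) f a (b * S y)); last first.
  rewrite -(sw_epsl (f := fun y => \sw_(a, b <- L) f a (b * S y))); last by lin_tac.
  by sw_ext => x y; rewrite Lh linearZ /= (linZ _ _ (@tliftP _ _ _ _ _)).
transitivity (\sw_(x, y <- h) \sw_(c, d <- x) \sw_(a, b <- L)
  f (a * c) (b * (d * S y))); last first.
  sw_ext => x y; rewrite swM //; last by lin_tac.
  rewrite tlift_exchange; sw_ext => a b; sw_ext => c d.
  by rewrite mulrA.
rewrite (swA (f := fun c d y => \sw_(a, b <- L) f (a * c) (b * (d * S y)))); [|lin_tac..].
rewrite -(sw_epsr (f := fun y => \sw_(a, b <- L) f (a * y) b)); last by lin_tac.
sw_ext => x y.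
rewrite (sw_antir (f := fun z => \sw_(a, b <- L) f (a * x) (b * z))); last by lin_tac.
by congr (_ *: _); sw_ext => a b; rewrite mulr1.
Qed.


Definition coordf (i : 'I_(\dim {:H})) : 'Hom(H, F^o) :=
  linfun (fun x : H => coord (vbasis {:H}) i x : F^o).

Lemma coordfE i x : coordf i x = coord (vbasis {:H}) i x.
Proof. by rewrite lin_linfun // => k y z; rewrite linearP. Qed.

Lemma coordf_sum x : x = \sum_(i < \dim {:H}) (coordf i x : F) *: (vbasis {:H})`_i.
Proof.
rewrite {1}(coord_vbasis (memvf x)).
by apply: eq_bigr => i _; rewrite coordfE.
Qed.

Lemma tlift_expandl W (f : H -> H -> W) t : bilin f ->
  tlift f t =
  \sum_(i < \dim {:H}) f (vbasis {:H})`_i (tlift (fun a b => (coordf i a : F) *: b) t).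
Proof.
move=> bf; rewrite -(@eq_tlift _ _ _ _
  (fun a b => \sum_(i < \dim {:H}) (coordf i a : F) *: f (vbasis {:H})`_i b)).
  rewrite tlift_sum; apply: eq_bigr => i _.
  rewrite (lin_tliftE _ _ (bf.2 _)).
  by sw_ext => a b; rewrite (linZ _ _ (bf.2 _)).
move=> a b; rewrite [in RHS](coordf_sum a).
by rewrite (lin_sum _ _ (bf.1 b)).
Qed.

Lemma tlift_expandr W (f : H -> H -> W) t : bilin f ->
  tlift f t =
  \sum_(i < \dim {:H}) f (tlift (fun a b => (coordf i b : F) *: a) t) (vbasis {:H})`_i.
Proof.
move=> bf; rewrite -(@eq_tlift _ _ _ _
  (fun a b => \sum_(i < \dim {:H}) (coordf i b : F) *: f a (vbasis {:H})`_i)).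
  rewrite tlift_sum; apply: eq_bigr => i _.
  rewrite (lin_tliftE _ _ (bf.1 _)).
  by sw_ext => a b; rewrite (linZ _ _ (bf.1 _)).
move=> a b; rewrite [in RHS](coordf_sum b).
by rewrite (lin_sum _ _ (bf.2 a)).
Qed.

Definition int_act (p : 'Hom(H, F^o)) : H := \sw_(a, b <- L) ((p b : F) *: a).

Lemma lin_int_act : lin int_act.
Proof.
rewrite /int_act; apply: lin_tlift_body => a b k p q.
by rewrite !lfunE /= lfunE /= scalerDl scalerA.
Qed.

(* [p k = p (k S(L_1) L_2)], and [L_1 (x) h L_2 = S(h) L_1 (x) L_2] rewrites  *)
(* the right-hand side in terms of [int_act p].                              *)
Lemma int_act_inj p : int_act p = 0 -> p = 0.
Proof.
move=> p0.
have p0' h : \sw_(a, b <- L) ((p (h * b) : F) *: a) = 0.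
  rewrite (sw_int_movel (f := fun a b => (p b : F) *: a)); last by lin_tac.
  rewrite -(mulr0 (S h)) -p0 /int_act (lin_tliftE (u := fun x => S h * x)); last by lin_tac.
  by sw_ext => a b; rewrite scalerAr.
apply/lfunP => k; rewrite lfunE /= -[k]mulr1.
have := sw_antil (f := fun z => p (k * z)) L; rewrite epsL scale1r => <-; last by lin_tac.
rewrite -(@eq_tlift _ _ _ _ (fun a b => \sum_(i < \dim {:H}) (coordf i a : F) *: p (k * S (vbasis {:H})`_i * b))).
  rewrite tlift_sum big1 // => i _.
  transitivity (coordf i (\sw_(a, b <- L) ((p (k * S (vbasis {:H})`_i * b) : F) *: a))).
    rewrite (lin_tliftE (u := fun x => coordf i x)); last by lin_tac.
    by sw_ext => a b; rewrite [RHS]linearZ /= [LHS]mulrC.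
  by rewrite p0' linear0.
move=> a b; rewrite [in RHS](coordf_sum a).
have lf : lin (fun a => p (k * (S a * b))) by lin_tac.
rewrite (lin_sum _ _ lf); apply: eq_bigr => i _; by rewrite mulrA.
Qed.

Lemma int_act_surj h : exists p, int_act p = h.
Proof.
pose Phi := linfun int_act.
have PhiE := lin_linfun lin_int_act.
have ker0 : lker Phi = 0%VS.
  apply/eqP; rewrite -subv0; apply/subvP => p.
  by rewrite memv_ker PhiE memv0 => /eqP/int_act_inj->.
have : h \in limg Phi.
  suff -> : limg Phi = fullv by exact: memvf.
  apply/eqP; rewrite eqEdim subvf /=.
  have := limg_ker_dim Phi fullv; rewrite ker0 capv0 dimv0 add0n => ->.
  by rewrite !dimvf /dim /= muln1.
by case/memv_imgP => p _ ->; exists p; rewrite PhiE.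
Qed.

(** * The Frobenius form [lam], the antipode and Radford's formula *)

Section Frobenius.

Variable lam : 'Hom(H, F^o).
Hypothesis lamP : int_act lam = 1.

Lemma lam_int : lam L = 1.
Proof.
rewrite -(counit1 A) -lamP /int_act.
rewrite (lin_tliftE (u := fun x => eps x : F^o)); last by lin_tac.
rewrite -(sw_epsl (f := fun b => lam b)); last by lin_tac.
by sw_ext => a b; rewrite linearZ /= mulrC.
Qed.

Lemma int_act_ext p q : int_act p = int_act q -> p = q.
Proof.
move=> pq; apply/eqP; rewrite -subr_eq0; apply/eqP; apply: int_act_inj.
have := lin_int_act (-1) q p; rewrite !scaleN1r pq addNr => <-.
by rewrite addrC.
Qed.

(** Paired with any [q], both sides become functionals of [h] with the same image [q(1) 1] under the
    injective [int_act], by coassociativity. *)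
Lemma lam_left_int h : \sw_(a, b <- h) ((lam b : F) *: a) = (lam h : F) *: 1.
Proof.
apply: functional_ext => q.
pose p1 h : F^o := \sw_(a, b <- h) ((lam b : F) *: q a).
pose p2 h : F^o := (lam h : F) *: (q 1).
have l1 : lin p1 by rewrite /p1; lin_tac.
have l2 : lin p2 by rewrite /p2; lin_tac.
suff /lfunP/(_ h) : linfun p1 = linfun p2.
  rewrite !lin_linfun // /p1 /p2 linearZ /= => <-.
  rewrite (lin_tliftE (u := fun x => q x)); last by lin_tac.
  by sw_ext => a b; rewrite linearZ.
apply: int_act_ext; rewrite /int_act.
transitivity ((q 1 : F) *: (1 : H)); last first.
  rewrite -[X in _ *: X = _]lamP /int_act tliftZ.
  by sw_ext => a b; rewrite lin_linfun // scalerA mulrC.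
transitivity (\sw_(x, y <- L) \sw_(a, b <- y) ((lam b * q a : F) *: x)).
  sw_ext => x y; rewrite lin_linfun // /p1 -tlift_scalel.
  by sw_ext.
rewrite -(swA (f := fun x a b => (lam b * q a : F) *: x)); last 3 first.
- by lin_tac.
- by move=> a b k x y; rewrite linearP mulrDr scalerDl scalerA mulrCA.
- by move=> a b k x y; rewrite linearP mulrDl scalerDl scalerA mulrA.
rewrite -(sw1 (f := fun a b => (q b : F) *: a)); last by lin_tac.
rewrite -lamP /int_act [RHS](lin_tliftE (u := fun z => \sw_(a, b <- z) ((q b : F) *: a))); last by lin_tac.
sw_ext => x y; rewrite linearZ /= (linZ _ _ (@tliftP _ _ _ _ _)).
rewrite tliftZ.
by sw_ext => a b; rewrite scalerA.
Qed.

Definition left_int (p : 'Hom(H, F^o)) :=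
  forall h, \sw_(a, b <- h) ((p b : F) *: a) = (p h : F) *: 1.

Lemma left_int_unique p : left_int p -> forall h, p h = p L * lam h.
Proof.
move=> pint h; rewrite -[p L * _]/((p L : F) *: lam h) -scale_lfunE.
congr (fun_of_lfun _ h); apply: int_act_ext; rewrite {1}/int_act pint.
by rewrite (linZ _ _ lin_int_act) lamP.
Qed.

(* The distinguished grouplike element of [H]; it is [1] exactly when the    *)
(* left integral [lam] of the dual is also a right integral.                *)
Definition modg : H := \sw_(a, b <- L) ((lam a : F) *: b).
Local Notation g := modg.

(** For every [q] the convolution of [lam] and [q] is again a left integral, hence a multiple of
    [lam]. *)
Lemma lam_modg h : \sw_(a, b <- h) ((lam a : F) *: b) = (lam h : F) *: g.
Proof.
apply: functional_ext => q.
pose p h : F^o := \sw_(a, b <- h) ((lam a : F) *: q b).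
have lp : lin p by rewrite /p; lin_tac.
have pE x : q (\sw_(a, b <- x) ((lam a : F) *: b)) = p x.
  rewrite (lin_tliftE (u := fun x => q x)); last by lin_tac.
  by sw_ext => a b; rewrite linearZ.
rewrite [RHS]linearZ /= /modg !pE -[RHS]/(lam h * p L) mulrC.
rewrite -!(lin_linfun lp); apply: left_int_unique.
move=> {}h; rewrite !lin_linfun //.
transitivity (\sw_(x, y <- h) \sw_(a, b <- y) ((lam a * q b : F) *: x)).
  sw_ext => x y; rewrite lin_linfun // /p -tlift_scalel.
  by sw_ext.
rewrite -(swA (f := fun x a b => (lam a * q b : F) *: x)); last 3 first.
- by lin_tac.
- by move=> a b k x y; rewrite linearP mulrDl scalerDl scalerA mulrA.
- by move=> a b k x y; rewrite linearP mulrDr scalerDl scalerA mulrCA.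
rewrite /p -tlift_scalel; sw_ext => x y.
rewrite -[RHS]/((lam x * q y : F) *: 1) [in RHS]mulrC -scalerA.
rewrite -(lam_left_int x) tliftZ.
by sw_ext => a b; rewrite scalerA mulrC.
Qed.

Lemma modg_comul W (f : H -> H -> W) : bilin f -> \sw_(a, b <- g) f a b = f g g.
Proof.
move=> bf; rewrite {1}/modg.
rewrite (lin_tliftE (u := fun z => \sw_(a, b <- z) f a b)); last by lin_tac.
transitivity (\sw_(x, y <- L) \sw_(a, b <- y) ((lam x : F) *: f a b)).
  sw_ext => x y; rewrite linearZ (linZ _ _ (@tliftP _ _ _ _ _)).
  by rewrite tliftZ.
rewrite -(swA (f := fun x a b => (lam x : F) *: f a b)); [|lin_tac..].
transitivity (\sw_(x, y <- L) ((lam x : F) *: f g y)).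
  sw_ext => x y.
  rewrite -(linZ _ _ (bf.1 _)) -lam_modg (lin_tliftE (u := fun z => f z y)); last by lin_tac.
  by sw_ext => a b; rewrite (linZ _ _ (bf.1 _)).
rewrite {2}/modg (lin_tliftE (u := fun z => f g z)); last by lin_tac.
by sw_ext => x y; rewrite (linZ _ _ (bf.2 _)).
Qed.

Lemma eps_modg : eps g = 1.
Proof.
rewrite /modg (lin_tliftE (u := fun x => eps x : F^o)); last by lin_tac.
rewrite -lam_int -[RHS](sw_epsr (f := fun x => lam x)); last by lin_tac.
sw_ext => a b.
by rewrite linearZ /= mulrC.
Qed.

(** Both sides equal [S(h_1) h_2 k_1 lam(h_3 k_2)]. *)
Lemma lam_movel h k :
  \sw_(a, b <- h) ((lam (b * k) : F) *: S a) =
  \sw_(a, b <- k) ((lam (h * b) : F) *: a).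
Proof.
transitivity (\sw_(x, y <- h) \sw_(a, b <- y * k) ((lam b : F) *: (S x * a))).
  sw_ext => x y.
  rewrite -[S x in LHS]mulr1 scalerAr -lam_left_int.
  rewrite (lin_tliftE (u := fun z => S x * z)); last by lin_tac.
  by sw_ext => a b; rewrite scalerAr.
transitivity (\sw_(c, d <- k) \sw_(x, y <- h) \sw_(a, b <- y)
    ((lam (b * d) : F) *: (S x * (a * c)))).
  rewrite [RHS]tlift_exchange; sw_ext => x y.
  by rewrite swM; [exact: tlift_exchange | lin_tac].
sw_ext => c d.
rewrite -(swA (f := fun x a b => (lam (b * d) : F) *: (S x * (a * c)))); [|lin_tac..].
rewrite -[RHS](sw_epsl (f := fun b => (lam (b * d) : F) *: c)); last by lin_tac.
sw_ext => x y; rewrite -[c in RHS]mul1r.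
rewrite -(sw_antil (f := fun z => (lam (y * d) : F) *: (z * c))); last by lin_tac.
by sw_ext => a b; rewrite mulrA.
Qed.

Lemma lam_mulint h : lam (h * L) = eps h.
Proof. by rewrite hL linearZ /= lam_int; exact: mulr1. Qed.

(** This formula, rather than convolution inverses, is what gives the anti-multiplicativity and
    injectivity of [S] below. *)
Lemma antiE h : S h = \sw_(a, b <- L) ((lam (h * b) : F) *: a).
Proof.
rewrite -lam_movel -[LHS](sw_epsr (f := fun a => S a)); last by lin_tac.
by sw_ext => a b; rewrite lam_mulint.
Qed.

Lemma lam_mover h k :
  \sw_(a, b <- h) ((lam (a * k) : F) *: b) =
  \sw_(a, b <- k) ((lam (h * a) : F) *: (g * S b)).
Proof.
transitivity (\sw_(x, y <- k) \sw_(a, b <- h * x) ((lam a : F) *: (b * S y))); last first.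
  sw_ext => x y.
  rewrite scalerAl -lam_modg.
  rewrite (lin_tliftE (u := fun z => z * S y)); last by lin_tac.
  by sw_ext => a b; rewrite scalerAl.
transitivity (\sw_(c, d <- h) \sw_(x, y <- k) \sw_(a, b <- x)
    ((lam (c * a) : F) *: (d * (b * S y)))); last first.
  rewrite tlift_exchange; sw_ext => x y.
  rewrite swM; last by lin_tac.
  by sw_ext => a b; sw_ext => c d; rewrite mulrA.
sw_ext => c d.
rewrite (swA (f := fun a b y => (lam (c * a) : F) *: (d * (b * S y)))); [|lin_tac..].
rewrite -[LHS](sw_epsr (f := fun a => (lam (c * a) : F) *: d)); last by lin_tac.
sw_ext => x y.
rewrite (sw_antir (f := fun z => (lam (c * x) : F) *: (d * z))); last by lin_tac.
by rewrite mulr1.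
Qed.

Lemma lam_expand h : h = \sw_(a, b <- L) ((lam (h * a) : F) *: (g * S b)).
Proof.
rewrite -lam_mover -[LHS](sw_epsl (f := fun a => a)); last by lin_tac.
by sw_ext => a b; rewrite lam_mulint.
Qed.

Lemma antiM h k : S (h * k) = S k * S h.
Proof.
rewrite antiE.
transitivity (\sw_(a, b <- L) ((lam (h * (k * b)) : F) *: a)).
  by sw_ext => a b; rewrite mulrA.
rewrite (sw_int_movel (f := fun a b => (lam (h * b) : F) *: a)); last by lin_tac.
rewrite (antiE h) (lin_tliftE (u := fun z => S k * z)); last by lin_tac.
by sw_ext => a b; rewrite scalerAr.
Qed.

Lemma anti1 : S 1 = 1.
Proof. by rewrite antiE -lamP; sw_ext => a b; rewrite lamP mul1r. Qed.

Lemma lam_nondeg h : (forall k, lam (h * k) = 0) -> h = 0.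
Proof.
move=> h0; rewrite (lam_expand h) /tlift big1 // => i _.
by rewrite big1 // => j _; rewrite h0 scale0r scaler0.
Qed.

Lemma anti_inj : injective S.
Proof.
suff ker0 h : S h = 0 -> h = 0.
  move=> h k hk; apply/eqP; rewrite -subr_eq0; apply/eqP/ker0.
  by rewrite linearB /= hk subrr.
move=> Sh; apply: lam_nondeg => k.
have lp : lin (fun x => lam (h * x)) by lin_tac.
suff /lfunP/(_ k) : linfun (fun x => lam (h * x)) = 0 by rewrite lin_linfun // lfunE.
apply: int_act_inj; rewrite -Sh antiE; sw_ext => a b.
by rewrite lin_linfun.
Qed.

Lemma anti_comul W (f : H -> H -> W) h : bilin f ->
  \sw_(a, b <- S h) f a b = \sw_(a, b <- h) f (S b) (S a).
Proof.
move=> bf.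
transitivity (\sw_(x, y <- L) \sw_(a, b <- h) ((lam (b * y) : F) *: f x (S a))); last first.
  rewrite tlift_exchange; sw_ext => a b.
  rewrite (antiE b) (lin_tliftE (u := fun z => f z (S a))); last by lin_tac.
  by sw_ext => x y; rewrite (linZ _ _ (bf.1 _)).
transitivity (\sw_(x, y <- L) \sw_(a, b <- y) ((lam (h * b) : F) *: f x a)); last first.
  sw_ext => x y.
  transitivity (f x (\sw_(a, b <- y) ((lam (h * b) : F) *: a))).
    rewrite (lin_tliftE (u := fun z => f x z)); last by lin_tac.
    by sw_ext => a b; rewrite (linZ _ _ (bf.2 _)).
  rewrite -lam_movel (lin_tliftE (u := fun z => f x z)); last by lin_tac.
  by sw_ext => a b; rewrite (linZ _ _ (bf.2 _)).
rewrite -(swA (f := fun x a b => (lam (h * b) : F) *: f x a)); [|lin_tac..].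
rewrite antiE (lin_tliftE (u := fun z => \sw_(a, b <- z) f a b)); last by lin_tac.
sw_ext => x y.
by rewrite linearZ (linZ _ _ (@tliftP _ _ _ _ _)) tliftZ.
Qed.

Lemma eps_anti h : eps (S h) = eps h.
Proof.
rewrite antiE (lin_tliftE (u := fun x => eps x : F^o)); last by lin_tac.
transitivity (lam (h * L)); last exact: lam_mulint.
rewrite -(sw_epsl (f := fun x => lam (h * x))); last by lin_tac.
sw_ext => a b.
by rewrite linearZ /= mulrC.
Qed.

Let Si := (S^-1)%VF.

Lemma antiVK : cancel Si S.
Proof.
move=> h; apply: lker0_lfunVK; apply/lker0P; exact: anti_inj.
Qed.

Lemma antiK : cancel S Si.
Proof. apply: lker0_lfunK; apply/lker0P; exact: anti_inj. Qed.

(** [S L] is a left integral, so [L * S L] equals [S L]; it also equals [L], which is a right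
    integral. *)
Lemma anti_int : S L = L.
Proof.
have mS h : h * S L = eps h *: S L.
  by rewrite -{1}(antiVK h) -antiM Lh linearZ /= -[in RHS](antiVK h) eps_anti.
have := mS L; rewrite epsL scale1r => <-.
by rewrite Lh eps_anti epsL scale1r.
Qed.

Lemma sw_int_anti W (f : H -> H -> W) : bilin f ->
  \sw_(a, b <- L) f a b = \sw_(a, b <- L) f (S b) (S a).
Proof. by move=> bf; rewrite -{1}anti_int anti_comul. Qed.

Lemma modgV : S g * g = 1.
Proof.
rewrite -(modg_comul (f := fun a b => S a * b)); last by lin_tac.
by rewrite antipodel eps_modg scale1r.
Qed.

Lemma modgVr : g * S g = 1.
Proof.
rewrite -(modg_comul (f := fun a b => a * S b)); last by lin_tac.
by rewrite antipoder eps_modg scale1r.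
Qed.

Lemma anti2_modg : S (S g) = g.
Proof.
by rewrite -[LHS]mul1r -modgVr -mulrA -antiM modgV anti1 mulr1.
Qed.

Lemma functional_lam (p : 'Hom(H, F^o)) : exists h, forall k, p k = lam (h * k).
Proof.
pose Psi := linfun (fun h => linfun (fun k => lam (h * k))).
have lam_lin h : lin (fun k => lam (h * k)) by lin_tac.
have lPsi : lin (fun h => linfun (fun k => lam (h * k))).
  move=> c x y; apply/lfunP => k.
  by rewrite lfunE /= lfunE /= !lin_linfun // mulrDl -scalerAl linearP.
have ker0 : lker Psi = 0%VS.
  apply/eqP; rewrite -subv0; apply/subvP => h.
  rewrite memv_ker lin_linfun // memv0 => /eqP/lfunP h0.
  by apply/eqP/lam_nondeg => k; have := h0 k; rewrite lin_linfun // lfunE.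
have : p \in limg Psi.
  suff -> : limg Psi = fullv by exact: memvf.
  apply/eqP; rewrite eqEdim subvf /=.
  have := limg_ker_dim Psi fullv; rewrite ker0 capv0 dimv0 add0n => ->.
  by rewrite !dimvf /dim /= muln1.
by case/memv_imgP => h _ ->; exists h => k; rewrite !lin_linfun.
Qed.

(** Contract one leg with a coordinate functional written as [lam (h * _)]: both sides become [S h],
    once by [antiE] and once by [lam_expand]. *)
Lemma sw_int_swap W (f : H -> H -> W) : bilin f ->
  \sw_(a, b <- L) f b a = \sw_(a, b <- L) f a (S (S b) * S g).
Proof.
move=> bf.
rewrite (tlift_expandr (f := fun a b => f b a)); last by lin_tac.
rewrite [RHS](tlift_expandl (f := fun a b => f a (S (S b) * S g))); last by lin_tac.
apply: eq_bigr => i _; congr (f _ _).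
have [h hp] := functional_lam (coordf i).
transitivity (S h).
  by rewrite antiE; sw_ext => a b; rewrite hp.
rewrite {1}(lam_expand h) (lin_tliftE (u := fun z => S z)); last by lin_tac.
rewrite (lin_tliftE (u := fun z => S (S z) * S g)); last by lin_tac.
sw_ext => a b.
by rewrite !linearZ /= hp -scalerAl antiM.
Qed.

Lemma sw_int_unswap W (f : H -> H -> W) : bilin f ->
  \sw_(a, b <- L) f a b = \sw_(a, b <- L) f b (g * S (S a)).
Proof.
move=> bf; rewrite sw_int_anti //.
rewrite (sw_int_swap (f := fun x y => f (S x) (S y))); last by lin_tac.
rewrite [RHS](sw_int_anti (f := fun a b => f b (g * S (S a)))); last by lin_tac.
by sw_ext => a b; rewrite antiM anti2_modg.
Qed.

(* Radford's formula for [S^4]; there is no distinguished grouplike element  *)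
(* of the dual in it, because [L] is a two-sided integral.                   *)
Lemma anti4 h : h = g * S (S (S (S h))) * S g.
Proof.
rewrite {1}(lam_expand h).
rewrite sw_int_unswap; last by lin_tac.
rewrite (sw_int_swap (f := fun x y => (lam (h * x) : F) *: (g * S (g * S (S y))))); last by lin_tac.
rewrite {2}(lam_expand h).
rewrite (lin_tliftE (u := fun z => g * S (S (S (S z))) * S g)); last by lin_tac.
sw_ext => a b; rewrite !linearZ /= -scalerAr -scalerAl.
by rewrite !antiM !anti2_modg !mulrA.
Qed.

(** By [antiE], [f (S h) = lam(h L_2) f(L_1)], a sum of rank-one maps. *)
Lemma trace_anti (f : 'End(H)) :
  lfun_trace (f \o S)%VF = \sw_(a, b <- L) lam (f a * b).
Proof.
rewrite (trace_tlift (t := Delta L) (p := fun h a b => lam (h * b)) (y := fun a b => f a)) //.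
  by lin_tac.
move=> h; rewrite comp_lfunE antiE (lin_tliftE (u := fun z => f z)); last by lin_tac.
by sw_ext => a b; rewrite linearZ.
Qed.

Lemma lfun_trace_anti2 : lfun_trace (S \o S)%VF = lam 1.
Proof.
rewrite trace_anti (sw_antil (f := fun z => lam z)); last by lin_tac.
by rewrite epsL scale1r.
Qed.

Definition chi k : F^o := lfun_trace (amull k).

(** The element representing the regular character through [lam] ([chiE]); it also makes [S^2] inner
    ([casimir_comm]). *)
Definition casimir : H := \sw_(a, b <- L) (g * S b * a).

Lemma chiE k : chi k = lam (k * casimir).
Proof.
rewrite /chi (trace_tlift (t := Delta L) (p := fun h a b => lam (h * a))
   (y := fun a b => k * (g * S b))).
- rewrite /casimir (lin_tliftE (u := fun z => lam (k * z))); last by lin_tac.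
  by sw_ext => a b; rewrite !mulrA.
- by lin_tac.
move=> h; rewrite lfunE /= {1}(lam_expand h) (lin_tliftE (u := fun z => k * z)); last by lin_tac.
by sw_ext => a b; rewrite -scalerAr.
Qed.

Lemma chi1 : chi 1 = (\dim {:H})%:R.
Proof.
rewrite /chi trace_idem; last by move=> v; rewrite !lfunE /= !mul1r.
suff -> : limg (amull (1 : H)) = fullv by [].
apply/eqP; rewrite eqEsubv subvf /=; apply/subvP => v _.
by apply/memv_imgP; exists v; rewrite ?memvf // lfunE /= mul1r.
Qed.

Lemma chi_int : chi L = 1.
Proof.
rewrite /chi (trace_expand (I := unit) (p := fun _ h => eps h) (y := fun=> L)).
- by rewrite big_const card_unit /= addr0.
- by move=> _; lin_tac.
- by move=> v; rewrite lfunE /= Lh big_const card_unit /= addr0.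
Qed.

Lemma lin_chi : lin chi.
Proof. by move=> c x y; rewrite !chiE mulrDl -scalerAl linearP. Qed.

Lemma chiC h k : chi (h * k) = chi (k * h).
Proof.
have E x y : amull (x * y) = (amull x \o amull y)%VF.
  by apply/lfunP => z; rewrite comp_lfunE !lfunE /= mulrA.
by rewrite /chi !E trace_comp.
Qed.

Lemma casimir_comm h : casimir * S (S h) = h * casimir.
Proof.
have cE x : casimir * x = g * S (S x) * S g * casimir.
  rewrite {1}/casimir (lin_tliftE (u := fun z => z * x)); last by lin_tac.
  transitivity (\sw_(a, b <- L) (g * S b * (a * x))).
    by sw_ext => a b; rewrite mulrA.
  rewrite (sw_int_mover (f := fun a b => g * S b * a)); last by lin_tac.
  rewrite /casimir (lin_tliftE (u := fun z => g * S (S x) * S g * z)); last by lin_tac.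
  sw_ext => a b; rewrite antiM.
  by rewrite !mulrA -[g * S (S x) * S g * g]mulrA modgV mulr1.
by rewrite cE -anti4.
Qed.

Definition rcontract (p : H -> F^o) h : H := \sw_(a, b <- h) ((p b : F) *: a).

(** By [trace_anti] and anticomultiplicativity the trace is [p(S L_1) lam(S(L_2) L_3)], whose last
    two legs collapse. *)
Lemma trace_rcontract (p : H -> F^o) (C : 'End(H)) :
  lin p -> (forall h, C h = rcontract p h) ->
  lfun_trace (C \o S \o S)%VF = p L * lam 1.
Proof.
move=> lp CE; rewrite trace_anti.
have lpS : lin (fun x => p (S x)) by apply: (lin_comp lp); lin_tac.
transitivity (\sw_(x, y <- L) \sw_(a, b <- x) ((p (S a) : F) *: lam (S b * y))).
  sw_ext => x y; rewrite comp_lfunE CE /rcontract.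
  rewrite anti_comul; last by lin_tac.
  rewrite (lin_tliftE (u := fun z => lam (z * y))); last by lin_tac.
  by sw_ext => a b; rewrite -scalerAl linearZ.
rewrite (swA (f := fun a b y => (p (S a) : F) *: lam (S b * y))); [|lin_tac..].
rewrite -[in RHS]anti_int -[RHS]/((p (S L) : F) *: lam 1).
rewrite -[RHS](sw_epsr (f := fun x => (p (S x) : F) *: lam 1)); last by lin_tac.
sw_ext => x y.
rewrite -(sw_antil (f := fun z => (p (S x) : F) *: lam z)) //.
by lin_tac.
Qed.

(** On characters this says that [H (x) H] is free of rank [dim H]. In the computation the inner
    legs of the coproduct of [casimir] collapse, because [chi] is a trace form. *)
Lemma chi_chi h : g = 1 ->
  \sw_(a, b <- h) ((chi a : F) *: chi b) = (\dim {:H})%:R * chi h.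
Proof.
move=> g1; have lchi := lin_chi.
have lchiS : lin (fun x => chi (S x)) by apply: (lin_comp lchi); lin_tac.
transitivity (\sw_(x, y <- casimir) ((lam (h * x) : F) *: chi (S y))).
  transitivity (lam (\sw_(x, y <- h) ((lam (x * casimir) : F) *: y) * casimir)).
    rewrite (lin_tliftE (u := fun z => lam (z * casimir))); last by lin_tac.
    by sw_ext => x y; rewrite !chiE -scalerAl linearZ.
  rewrite lam_mover (lin_tliftE (u := fun z => lam (z * casimir))); last by lin_tac.
  by sw_ext => x y; rewrite chiE -scalerAl linearZ g1 mul1r.
rewrite [X in Delta X](_ : _ = \sw_(a, b <- L) (S b * a)); last first.
  by sw_ext => a b; rewrite g1 mul1r.
pose T p q u v : F^o := (lam (h * (S v * p)) : F) *: chi (S (S u * q)).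
rewrite (lin_tliftE (u := fun z => \sw_(x, y <- z) ((lam (h * x) : F) *: chi (S y)))); last by lin_tac.
transitivity (\sw_(a, b <- L) \sw_(p, q <- a) \sw_(u, v <- b) T p q u v).
  sw_ext => a b.
  rewrite swM; last by lin_tac.
  rewrite anti_comul; last by lin_tac.
  by rewrite tlift_exchange; sw_ext.
rewrite /T (swA (f := fun p q b => \sw_(u, v <- b)
  ((lam (h * (S v * p)) : F) *: chi (S (S u * q))))); [|lin_tac..].
rewrite chiE -chi1.
have -> : casimir = \sw_(a, b <- L) (S b * a).
  by sw_ext => a b; rewrite g1 mul1r.
rewrite (lin_tliftE (u := fun z => lam (h * z))); last by lin_tac.
rewrite -[RHS]/((chi 1 : F) *: (_ : F^o)) tliftZ; sw_ext => p w.
rewrite -(swA (f := fun q u v =>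
  (lam (h * (S v * p)) : F) *: chi (S (S u * q)))); [|lin_tac..].
rewrite -(sw_epsl (f := fun v => (chi 1 : F) *: lam (h * (S v * p)))); last by lin_tac.
sw_ext => r v.
transitivity (\sw_(q, u <- r) ((lam (h * (S v * p)) : F) *: chi (S (q * S u)))).
  by sw_ext => q u; rewrite !antiM chiC.
rewrite (sw_antir (f := fun z => (lam (h * (S v * p)) : F) *: chi (S z))); last by lin_tac.
by rewrite anti1; congr (_ *: _); exact: mulrC.
Qed.


Lemma modg_comulX W (f : H -> H -> W) n : bilin f ->
  \sw_(a, b <- g ^+ n) f a b = f (g ^+ n) (g ^+ n).
Proof.
elim: n f => [|n IHn] f bf; first by rewrite sw1.
rewrite exprS swM // modg_comul; last by lin_tac.
by rewrite (IHn (fun c d => f (g * c) (g * d))) //; lin_tac.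
Qed.

Lemma modgVX n : S g ^+ n * g ^+ n = 1.
Proof.
elim: n => [|n IHn]; first by rewrite !expr0 mulr1.
by rewrite exprSr exprS mulrA -[_ * S g * g]mulrA modgV mulr1.
Qed.

Lemma modg_order : exists2 N, (0 < N)%N & g ^+ N = 1.
Proof.
have epsgX n : eps (g ^+ n) = 1.
  by elim: n => [|n IHn]; rewrite ?expr0 ?counit1 // exprS counitM eps_modg mul1r.
pose X (k : nat) := [seq g ^+ i | i <- iota 0 k].
have sX (k : nat) : size (X k) = k by rewrite size_map size_iota.
have nfree : exists k : nat, ~~ free (X k).
  exists (\dim {:H}).+1; apply/negP; rewrite /free sX => /eqP E.
  by have := dimvS (subvf <<X (\dim {:H}).+1>>%VS); rewrite E ltnn.
have [k nfk kmin] := ex_minnP nfree.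
case: k nfk kmin => [|k] nfk kmin; first by rewrite /X /= nil_free in nfk.
have fk : free (X k) by apply: contraT => /kmin; rewrite ltnn.
have : g ^+ k \in <<X k>>%VS.
  apply: contraNT nfk => nspan; rewrite /X -addn1 iotaD map_cat /= add0n.
  rewrite (perm_free (_ : perm_eq _ (g ^+ k :: X k))) ?free_cons ?nspan //.
  by rewrite cats1 perm_rcons.
pose t := in_tuple (X k).
have tE (i : 'I_(size (X k))) : t`_i = g ^+ i.
  have ik : (i < k)%N by rewrite -{2}(sX k) ltn_ord.
  by rewrite /t /= (nth_map 0%N) ?size_iota // nth_iota.
move=> /(@coord_span _ _ _ t) gkE.
pose c i := coord t i (g ^+ k).
have lcoord i : lin (fun x => coord t i x : F^o) by move=> a x y; rewrite linearP.
(* Evaluating [coord i (x) coord j] on [g^k (x) g^k], the coproduct of [g^k], shows the coefficients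
   of [g^k] in the lower powers to be orthogonal idempotents of [F]; hence [g^k] is one of those
   powers. *)
have cc i j : c i * c j = if i == j then c i else 0.
  have bq : bilin (fun a b => (coord t i a : F) *: (coord t j b : F^o)).
    split=> b; first exact: lin_scalel (lcoord i).
    exact: lin_scaler (lcoord j).
  rewrite -[c i * c j](modg_comulX k bq) {1}gkE.
  have lsw : lin (fun z => \sw_(a, b <- z) ((coord t i a : F) *: (coord t j b : F^o))).
    by apply: lin_tlift; lin_tac.
  rewrite (lin_sum _ _ lsw).
  transitivity (\sum_(l < size (X k)) c l * ((l == i)%:R * (l == j)%:R)).
    apply: eq_bigr => l _; rewrite tE (modg_comulX l bq) -tE.
    by rewrite !coord_free.
  rewrite (bigD1 i) //= eqxx mul1r big1 ?addr0; last first.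
    by move=> l li; rewrite (negPf li) mul0r mulr0.
  by case: (i == j); rewrite ?mulr1 ?mulr0.
have [i ci0] : exists i, c i != 0.
  apply/existsP; apply: contraT => /existsPn no.
  have := epsgX k; rewrite gkE big1 ?linear0 => [/esym/eqP|j _]; first by rewrite oner_eq0.
  by have := no j; rewrite negbK => /eqP; rewrite /c => ->; rewrite scale0r.
have ci1 : c i = 1 by apply: (mulfI ci0); rewrite cc eqxx mulr1.
have gki : g ^+ k = g ^+ i.
  rewrite gkE (bigD1 i) //= -/(c i) ci1 scale1r tE big1 ?addr0 // => j ji.
  have := cc i j; rewrite eq_sym (negPf ji) ci1 mul1r => cj0.
  by rewrite -/(c j) cj0 scale0r.
have ik : (i < k)%N by rewrite -{2}(sX k) ltn_ord.
exists (k - i)%N; first by rewrite subn_gt0.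
by rewrite -[LHS]mul1r -(modgVX i) -mulrA -exprD subnKC ?(ltnW ik) // gki.
Qed.

Lemma anti2_order : exists2 N, (0 < N)%N & forall h, iter N (S \o S)%VF h = h.
Proof.
have [N N0 gN] := modg_order.
have anti4V h : S (S (S (S h))) = S g * h * g.
  rewrite [in RHS](anti4 h) !mulrA modgV mul1r -mulrA modgV mulr1 //.
have iterE n h : iter n.*2 (S \o S)%VF h = S g ^+ n * h * g ^+ n.
  elim: n => [|n IHn]; first by rewrite !expr0 mul1r mulr1.
  by rewrite doubleS !iterS IHn !comp_lfunE anti4V exprS exprSr !mulrA.
exists N.*2; first by rewrite double_gt0.
have SgN : S g ^+ N = 1 by have := modgVX N; rewrite gN mulr1.
by move=> h; rewrite iterE gN SgN mul1r mulr1.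
Qed.

End Frobenius.
End Integral.
End SweedlerCalculus.

Lemma eqr_nat_char0 (F : fieldType) (m n : nat) : [pchar F] =i pred0 ->
  (m%:R == n%:R :> F) = (m == n).
Proof.
move=> /pcharf0P cF; wlog mn : m n / (m <= n)%N.
  by move=> W; case/orP: (leq_total m n) => mn; [|rewrite !(eq_sym _ n) eq_sym]; apply: W.
by rewrite eq_sym -subr_eq0 -natrB // cF subn_eq0 eqn_leq mn.
Qed.

(** * The antipode is an involution *)

Section Involution.

Variables (F : fieldType) (V : vectType F) (E phi : 'End(V)).
Hypotheses (F2 : 2%:R != 0 :> F) (EE : forall v, E (E v) = E v).
Hypotheses (phi2 : forall v, phi (phi v) = v).
Hypothesis (Ephi : forall v, E (phi v) = phi (E v)).

Lemma lfun_traceD (f f' : 'End(V)) : lfun_trace (f + f') = lfun_trace f + lfun_trace f'.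
Proof.
rewrite !lfun_traceE -big_split; apply: eq_bigr => i _.
by rewrite add_lfunE linearD.
Qed.

Lemma lfun_traceZ c (f : 'End(V)) : lfun_trace (c *: f) = c * lfun_trace f.
Proof.
rewrite !lfun_traceE mulr_sumr; apply: eq_bigr => i _.
by rewrite scale_lfunE linearZ.
Qed.

(** [a] and [b] are the ranks of the idempotents [(E + E phi) / 2] and [(E - E phi) / 2]. *)
Lemma trace_involution : exists a b : nat,
  [/\ lfun_trace (E \o phi)%VF = a%:R - b%:R, lfun_trace E = a%:R + b%:R,
      b = 0%N -> forall v, E (phi v) = E v &
      a = 0%N -> forall v, E (phi v) = - E v].
Proof.
pose P (s : F) : 'End(V) := 2%:R^-1 *: (E + s *: (E \o phi)%VF).
have PE s v : P s v = 2%:R^-1 *: (E v + s *: E (phi v)).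
  by rewrite scale_lfunE add_lfunE scale_lfunE comp_lfunE.
have half (x : F) : 2%:R^-1 * (x + x) = x.
  by rewrite -mulr2n -[x *+ 2]mulr_natl mulKf.
have Pidem s : s * s = 1 -> forall v, P s (P s v) = P s v.
  move=> ss v; rewrite [P s v]PE !PE !linearZ /= !linearD /= !linearZ /=.
  rewrite !EE !Ephi !phi2 EE -!Ephi; set u := E v; set w := E _.
  have cc : 2%:R^-1 * 2%:R^-1 + 2%:R^-1 * 2%:R^-1 = 2%:R^-1 :> F.
    by rewrite -mulrDr half.
  rewrite [X in _ + X]addrC addrACA !scalerA -!scalerDl; congr (_ *: _ + _ *: _).
    by rewrite -[_ * s * s]mulrA ss mulr1.
  by rewrite -!mulrA -mulrDr half.
have P1 : forall v, P 1 (P 1 v) = P 1 v by apply: Pidem; rewrite mulr1.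
have PN1 : forall v, P (-1) (P (-1) v) = P (-1) v by apply: Pidem; rewrite mulrNN mulr1.
have trP s : lfun_trace (P s) = 2%:R^-1 * (lfun_trace E + s * lfun_trace (E \o phi)%VF).
  by rewrite lfun_traceZ lfun_traceD lfun_traceZ.
exists (\dim (limg (P 1))), (\dim (limg (P (-1)))).
rewrite -!trace_idem // !trP; split.
- by rewrite -mulrBr mul1r mulN1r opprB [X in _ * X]addrC addrA subrK half.
- by rewrite -mulrDr mul1r mulN1r addrACA subrr addr0 half.
- move=> /eqP; rewrite dimv_eq0 => /eqP P0 v.
  have : P (-1) v = 0 by apply/eqP; rewrite -memv0 -P0 memv_img ?memvf.
  rewrite PE => /eqP; rewrite scaler_eq0 invr_eq0 (negPf F2) scaleN1r subr_eq0.
  by move/eqP.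
move=> /eqP; rewrite dimv_eq0 => /eqP P0 v.
have : P 1 v = 0 by apply/eqP; rewrite -memv0 -P0 memv_img ?memvf.
rewrite PE => /eqP; rewrite scaler_eq0 invr_eq0 (negPf F2) scale1r addrC.
by rewrite addr_eq0 => /eqP.
Qed.

End Involution.

Section LarsonRadford.

Variables (F : closedFieldType) (H : falgType F) (A : hopf_algebra H).
Hypotheses (cF : [pchar F] =i pred0) (ssH : semisimple_algebra H).
Variable L : H.
Hypothesis intL : normalized_integral A L.

Local Notation Delta := (comul A).
Local Notation eps := (counit A).
Local Notation S := (antipode A).
Local Notation n := (\dim {:H}).
Local Notation "'\sw_' ( a , b '<-' h ) E" :=
  (@tlift F H H _ (fun a b => E) (Delta h))
  (at level 36, a name, b name, h at level 50, E at level 36).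

Let natF k : (k%:R == 0 :> F) = (k == 0)%N. Proof. by move/pcharf0P: cF. Qed.

Let n0 : (0 < n)%N.
Proof.
rewrite lt0n dimv_eq0; apply/eqP => H0; have := memvf (1 : H).
by rewrite H0 memv0 oner_eq0.
Qed.

Section WithLambda.

Variable lam : 'Hom(H, F^o).
Hypothesis lamP : int_act A L lam = 1.

(** For [h = h k h] the idempotent [e = k h] has [chi e = lam (e * casimir) = 0]; but [chi e] is the
    rank of [e], so [e = 0] in characteristic zero. *)
Lemma casimir_reg h : h * casimir A L lam = 0 -> h = 0.
Proof.
move=> hc; have [k hkh] := von_neumann_regular ssH h.
pose e := k * h; have ee : e * e = e by rewrite /e -mulrA hkh.
have : chi e = 0 by rewrite (chiE intL lamP) /e -mulrA hc mulr0 linear0.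
rewrite /chi trace_idem => [/eqP|v]; last by rewrite !lfunE /= mulrA ee.
rewrite natF dimv_eq0 => /eqP e0; rewrite -hkh -/e.
have : e \in limg (amull e) by apply/memv_imgP; exists 1; rewrite ?memvf // lfunE /= mulr1.
by rewrite e0 memv0 => /eqP ->; rewrite mulr0.
Qed.

Lemma lam1_neq0 : lam 1 != 0.
Proof.
rewrite -(lfun_trace_anti2 intL lamP).
have [N N0 phiN] := anti2_order intL lamP.
apply: (trace_inner_neq0 cF ssH _ _ N0 phiN (a := casimir A L lam) (eps := eps)).
- by move=> a b; rewrite !comp_lfunE !(antiM intL lamP).
- by rewrite comp_lfunE !(anti1 intL lamP).
- by move=> h; rewrite comp_lfunE (casimir_comm intL lamP).
- exact: casimir_reg.
- exact: counit1.
exact: counitM.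
Qed.

Lemma modg1 : modg A L lam = 1.
Proof.
have := lam_modg intL lamP 1; rewrite sw1; last by lin_tac.
by move/(scalerI lam1_neq0).
Qed.

Lemma anti4_id h : S (S (S (S h))) = h.
Proof.
by rewrite [RHS](anti4 intL lamP) modg1 (anti1 intL lamP) mul1r mulr1.
Qed.

Let C : 'End(H) := linfun (rcontract A (@chi F H)).

Let CE h : C h = rcontract A (@chi F H) h.
Proof. by rewrite /C lin_linfun //; apply: lin_tlift; lin_tac. Qed.

Lemma rcontract_chi2 h : C (C h) = n%:R *: C h.
Proof.
rewrite [C h]CE {1}/rcontract (lin_tliftE (u := fun z => C z)); last by lin_tac.
have lchi := lin_chi intL lamP.
transitivity (\sw_(x, y <- h) \sw_(a, b <- x) ((chi y : F) *: ((chi b : F) *: a))).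
  by sw_ext => x y; rewrite linearZ /= CE /rcontract tliftZ.
rewrite (swA A (f := fun a b y => (chi y : F) *: ((chi b : F) *: a))); [|lin_tac..].
rewrite tliftZ; sw_ext => x y.
transitivity ((\sw_(a, b <- y) ((chi a : F) *: chi b) : F) *: x).
  rewrite -tlift_scalel; sw_ext => a b.
  by rewrite scalerA mulrC.
by rewrite (chi_chi intL lamP _ modg1) scalerA.
Qed.

Let phi : 'End(H) := (S \o S)%VF.

Let phi2 h : phi (phi h) = h. Proof. by rewrite /phi !comp_lfunE anti4_id. Qed.

(** Left multiplications by [h] and by [phi h] are conjugate under the algebra involution [phi]. *)
Lemma chi_anti2 h : chi (phi h) = chi h.
Proof.
have amullE : amull (phi h) = (phi \o (amull h \o phi))%VF.
  have amE a x : amull a x = a * x by rewrite lfunE.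
  apply/lfunP => x; rewrite /phi !comp_lfunE !amE !(antiM intL lamP).
  by rewrite anti4_id.
rewrite /chi amullE trace_comp; congr lfun_trace; apply/lfunP => x.
by rewrite /phi !comp_lfunE /= anti4_id.
Qed.

Lemma rcontract_chi_anti2 h : C (phi h) = phi (C h).
Proof.
have lchi := lin_chi intL lamP.
rewrite !CE /rcontract /phi comp_lfunE.
rewrite (anti_comul intL lamP); last by lin_tac.
rewrite (anti_comul intL lamP); last by lin_tac.
rewrite (lin_tliftE (u := fun z => phi z)); last by lin_tac.
sw_ext => a b; rewrite linearZ /= comp_lfunE.
by rewrite -[chi b]chi_anti2 /phi comp_lfunE.
Qed.

(* With [n = dim H], the operator [E = C / n] is idempotent and commutes with *)
(* the involution [phi = S^2], so [tr (E phi) = lam 1 / n] is an integer. Thus *)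
(* [n] divides [lam 1 = tr phi], which is nonzero and at most [n] in absolute  *)
(* value; hence all eigenvalues of [phi] are equal, and [phi 1 = 1].           *)
Lemma anti2_id_lam h : S (S h) = h.
Proof.
have F2 : 2%:R != 0 :> F by rewrite natF.
have nF : n%:R != 0 :> F by rewrite natF -lt0n.
have lchi := lin_chi intL lamP.
have [a [b [Dab nab b0 a0]]] : exists a b : nat,
   [/\ lam 1 = a%:R - b%:R, n = (a + b)%N, b = 0%N -> forall v, phi v = v & a = 0%N -> False].
  have id2 (v : H) : (\1 (\1 v))%VF = (\1 v)%VF by rewrite !id_lfunE.
  have idphi v : (\1 (phi v))%VF = phi (\1 v)%VF by rewrite !id_lfunE.
  have [a [b [tr1 tr2 b0 a0]]] := trace_involution F2 id2 phi2 idphi.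
  exists a, b; split.
  - by rewrite -tr1 comp_lfun1l (lfun_trace_anti2 intL lamP).
  - apply/eqP; have nE : lfun_trace (\1 : 'End(H))%VF = n%:R.
      by rewrite trace_idem ?lim1g // => v; rewrite !id_lfunE.
    by rewrite -(eqr_nat_char0 _ _ cF) -nE tr2 natrD.
  - by move=> bE v; have := b0 bE v; rewrite !id_lfunE.
  - move=> aE; have := a0 aE 1; rewrite !id_lfunE /phi comp_lfunE !(anti1 intL lamP) => /eqP.
    by rewrite -addr_eq0 -mulr2n -scaler_nat scaler_eq0 (negPf F2) oner_eq0.
have [c [d Ecd]] : exists c d : nat, n%:R^-1 * lam 1 = c%:R - d%:R.
  pose E : 'End(H) := n%:R^-1 *: C.
  have EE v : E v = n%:R^-1 *: C v by rewrite scale_lfunE.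
  have E2 v : E (E v) = E v.
    by rewrite !EE linearZ /= rcontract_chi2 [_ *: (n%:R *: _)]scalerA mulVf // scale1r.
  have Ephi v : E (phi v) = phi (E v) by rewrite !EE rcontract_chi_anti2 linearZ.
  have [c [d [tr1 _ _ _]]] := trace_involution F2 E2 phi2 Ephi.
  exists c, d; rewrite -tr1.
  have -> : (E \o phi)%VF = n%:R^-1 *: (C \o S \o S)%VF.
    by apply/lfunP => v; rewrite /phi comp_lfunE EE scale_lfunE !comp_lfunE.
  by rewrite lfun_traceZ (trace_rcontract intL lamP lchi CE) (chi_int intL) mul1r.
(* That is, [a - b = n (c - d)] with [n = a + b]; as [a <> b], this leaves only [a = 0] or
   [b = 0]. *)
have key : (a + n * d = b + n * c)%N.
  apply/eqP; rewrite -(eqr_nat_char0 _ _ cF) !natrD !natrM.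
  have : a%:R - b%:R = n%:R * (c%:R - d%:R) :> F by rewrite -Ecd mulVKf.
  move/eqP; rewrite subr_eq mulrBr => /eqP ->.
  by rewrite addrAC subrK addrC.
have bE : b = 0%N.
  have ab : a != b.
    by apply: contraNneq lam1_neq0 => ab; rewrite Dab ab subrr.
  have apos : (0 < a)%N by rewrite lt0n; apply/eqP => /a0.
  rewrite nab in key; have [cd|dc|cd] := ltngtP c d; last by move: key ab; rewrite cd; lia.
    by have := leq_mul (leqnn (a + b)) cd; rewrite mulnS; lia.
  by have := leq_mul (leqnn (a + b)) dc; rewrite mulnS; lia.
by have := b0 bE h; rewrite /phi comp_lfunE.
Qed.

End WithLambda.
Let exists_lam : exists lam, int_act A L lam = 1.
Proof. exact: int_act_surj intL 1. Qed.

Theorem anti2_id h : S (S h) = h.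
Proof. by have [lam lamP] := exists_lam; apply: anti2_id_lam lamP h. Qed.

Lemma int_anti : S L = L.
Proof. by have [lam lamP] := exists_lam; apply: anti_int lamP. Qed.

Lemma int_cocomm (W : vectType F) (f : H -> H -> W) : bilin f ->
  \sw_(a, b <- L) f b a = \sw_(a, b <- L) f a b.
Proof.
move=> bf; have [lam lamP] := exists_lam; rewrite (sw_int_swap intL lamP bf).
by sw_ext => a b; rewrite (modg1 lamP) (anti1 intL lamP) anti2_id mulr1.
Qed.

Lemma sw_anti (W : vectType F) (f : H -> H -> W) h : bilin f ->
  \sw_(a, b <- S h) f a b = \sw_(a, b <- h) f (S b) (S a).
Proof. by move=> bf; have [lam lamP] := exists_lam; apply: (anti_comul intL lamP). Qed.

Lemma trace_lcontract (p : H -> F^o) (C : 'End(H)) : lin p ->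
  (forall h, C h = \sw_(a, b <- h) ((p a : F) *: b)) ->
  lfun_trace C = n%:R * p L.
Proof.
move=> lp CE; have [lam lamP] := exists_lam.
have S2 : (S \o S)%VF = \1%VF.
  by apply/lfunP => h; rewrite comp_lfunE id_lfunE anti2_id.
have lamn : lam 1 = n%:R.
  rewrite -(lfun_trace_anti2 intL lamP) S2 trace_idem ?lim1g // => v.
  by rewrite !id_lfunE.
have lpS : lin (fun h => p (S h)) by lin_tac.
pose R := linfun (rcontract A (fun h => p (S h))).
have RE h : R h = rcontract A (fun h => p (S h)) h.
  by rewrite /R lin_linfun //; rewrite /rcontract; lin_tac.
have -> : C = (S \o (R \o S))%VF.
  apply/lfunP => h; rewrite !comp_lfunE RE CE /rcontract sw_anti; last by lin_tac.
  rewrite (lin_tliftE (u := fun z => S z)); last by lin_tac.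
  by sw_ext => a b; rewrite linearZ /= !anti2_id.
rewrite trace_comp.
rewrite (trace_rcontract intL lamP lpS RE) int_anti lamn.
exact: mulrC.
Qed.

Lemma twisting_mapE (tau : 'End(H)) : twisting_map A tau = tau.
Proof.
have [lam lamP] := exists_lam; apply/lfunP => h; rewrite !comp_lfunE.
have SiE x : (S^-1)%VF x = S x.
  by rewrite -{1}[x]anti2_id (antiK intL lamP).
by rewrite !SiE anti2_id.
Qed.

End LarsonRadford.

(** * Twisted powers and indicators *)

Section TwistedPowers.

Variables (F : fieldType) (H : falgType F) (A : hopf_algebra H).

Local Notation Delta := (comul A).
Local Notation eps := (counit A).
Local Notation "'\sw_' ( a , b '<-' h ) E" :=
  (@tlift F H H _ (fun a b => E) (Delta h))
  (at level 36, a name, b name, h at level 50, E at level 36).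

(** The convolution product of [f 0, ..., f (m-1)]; the empty product is the unit [eps], which gives
    inductions a base at [m = 0]. *)
Fixpoint conv_prod (f : nat -> H -> H) (m : nat) (h : H) : H :=
  if m is m'.+1 then \sw_(a, b <- h) (f 0%N a * conv_prod (fun i => f i.+1) m' b)
  else eps h *: 1.

Lemma eq_conv_prod f f' m h :
  (forall i a, f i a = f' i a) -> conv_prod f m h = conv_prod f' m h.
Proof.
elim: m f f' h => [|m IHm] f f' h ff' //=.
by sw_ext => a b; rewrite ff'; congr (_ * _); apply: IHm.
Qed.

Lemma lin_conv_prod f m : (forall i, lin (f i)) -> lin (conv_prod f m).
Proof. by case: m => [|m] lf /=; lin_tac. Qed.

Lemma lin_tpow_mul n (f : nat -> H -> H) :
  (forall i, lin (f i)) -> lin (@tpow_mul F H n f).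
Proof. by case: n => [|n] lf; [exact: lf | exact: tliftP]. Qed.

Lemma tpow_mul_iter_comul f n h : (forall i, lin (f i)) ->
  tpow_mul f (iter_comul A n h) = conv_prod f n.+1 h.
Proof.
elim: n f h => [|n IHn] f h lf.
  rewrite /= -[LHS](sw_epsr A h (lf 0%N)).
  by sw_ext => a b; rewrite -scalerAr mulr1.
have lfS i : lin (f i.+1) by apply: lf.
rewrite [LHS]/= tlift_tmap; last first.
  split=> [t|a].
    by apply: lin_mulr; apply: lf.
  by apply: lin_mull; apply: lin_tpow_mul.
by sw_ext => a b; rewrite IHn.
Qed.

Lemma conv_prodD f m k h : (forall i, lin (f i)) ->
  conv_prod f (m + k) h =
  \sw_(a, b <- h) (conv_prod f m a * conv_prod (fun i => f (m + i)%N) k b).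
Proof.
elim: m f h => [|m IHm] f h lf.
  have lk : lin (conv_prod (fun i => f (0 + i)%N) k) by apply: lin_conv_prod.
  rewrite -[LHS](sw_epsl A h lk).
  by sw_ext => a b; rewrite -scalerAl mul1r.
rewrite addSn /=.
have lS i : lin (f i.+1) by apply: lf.
have l0 : lin (f 0%N) by apply: lf.
pose f1 i := f i.+1; pose f2 i := f (m.+1 + i)%N.
have l1 : lin (conv_prod f1 m) by apply: lin_conv_prod.
have l2 : lin (conv_prod f2 k) by apply: lin_conv_prod => i; apply: lf.
transitivity (\sw_(x, y <- h) \sw_(a, b <- y) (f 0%N x * (conv_prod f1 m a * conv_prod f2 k b))).
  sw_ext => x y; rewrite IHm // (lin_tliftE (u := fun z => f 0%N x * z)); last by lin_tac.
  by sw_ext => a b.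
rewrite -(swA A (f := fun x a b => f 0%N x * (conv_prod f1 m a * conv_prod f2 k b))); [|lin_tac..].
sw_ext => x y; rewrite (lin_tliftE (u := fun z => z * conv_prod f2 k y)); last by lin_tac.
by sw_ext => a b; rewrite mulrA.
Qed.

Variable tau : 'End(H).

Definition tau_power m h := conv_prod (fun i => iter i tau) m h.

Lemma lin_iter i : lin (iter i tau).
Proof. by elim: i => [|i IHi] k x y; rewrite ?iterS ?IHi ?linearP. Qed.

Lemma lin_tau_power m : lin (tau_power m).
Proof. exact: lin_conv_prod lin_iter. Qed.

Lemma twisted_powerE m h : (0 < m)%N -> twisted_power A tau m h = tau_power m h.
Proof.
by move=> m0; rewrite /twisted_power (tpow_mul_iter_comul _ _ lin_iter) prednK.
Qed.

Lemma tau_powerD r m k h : (forall x, iter r tau x = x) -> (r %| m)%N ->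
  tau_power (m + k) h = \sw_(a, b <- h) (tau_power m a * tau_power k b).
Proof.
move=> taur rm; rewrite /tau_power conv_prodD; last exact: lin_iter.
sw_ext => a b; congr (_ * _); apply: eq_conv_prod => i x.
have itq q y : iter (q * r) tau y = y by elim: q => // q IHq; rewrite mulSn iterD IHq.
by rewrite addnC iterD -(divnK rm) itq.
Qed.

End TwistedPowers.

(** * Periodicity and integrality of the indicators *)

Section TwistedIndicator.

Variables (F : closedFieldType) (H : falgType F) (A : hopf_algebra H).
Hypotheses (cF : [pchar F] =i pred0) (ssH : semisimple_algebra H).
Variable L : H.
Hypothesis intL : normalized_integral A L.
Variables (tau : 'End(H)) (r : nat).
Hypotheses (tauA : hopf_automorphism A tau) (taur : forall h, iter r tau h = h).
Variables (V : vectType F) (rho : lmodule_str H V).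

Local Notation Delta := (comul A).
Local Notation eps := (counit A).
Local Notation n := (\dim {:H}).
Local Notation P := (tau_power A tau).
Local Notation "'\sw_' ( a , b '<-' h ) E" :=
  (@tlift F H H _ (fun a b => E) (Delta h))
  (at level 36, a name, b name, h at level 50, E at level 36).

Let rhoM a b v : rho (a * b) v = rho a (rho b v).
Proof. by rewrite lm_actM comp_lfunE. Qed.

Let lrho (U : vectType F) (g : U -> H) v : lin g -> lin (fun x => rho (g x) v).
Proof. by move=> lg k x y; rewrite lg linearP add_lfunE scale_lfunE. Qed.

Let lrho2 (U : vectType F) h (g : U -> V) : lin g -> lin (fun x => rho h (g x)).
Proof. by move=> lg; apply: lin_lfun. Qed.


Section Exponent.

Variable e : nat.
Hypothesis expe : forall h, rho (P (r * e) h) = eps h *: \1%VF.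

Lemma rho_tau_power_period m h : (r %| m)%N -> rho (P (m + r * e) h) = rho (P m h).
Proof.
move=> rm; apply/lfunP => v.
have lP k := lin_tau_power A tau k.
rewrite (tau_powerD A _ _ taur rm).
rewrite (lin_tliftE (u := fun z => rho z v)); last by apply: lrho; lin_tac.
have lPv : lin (fun h => rho (P m h) v) by apply: lrho; lin_tac.
rewrite -[RHS](sw_epsr A h lPv); sw_ext => a b.
by rewrite rhoM expe scale_lfunE id_lfunE linearZ.
Qed.

Lemma rho_tau_power_periodn m q h : (r %| m)%N ->
  rho (P (m + q * (r * e)) h) = rho (P m h).
Proof.
move=> rm; elim: q => [|q IHq]; first by rewrite addn0.
rewrite mulSn addnCA addnC rho_tau_power_period // dvdn_addr //.
by rewrite dvdn_mull // dvdn_mulr.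
Qed.

(* [m |-> T m] turns convolution powers into powers, and [tr (T m)] is         *)
(* [\dim H] times the indicator.                                              *)
Let T m : 'End('Hom(H, V)) :=
  linfun (fun w : 'Hom(H, V) => linfun (fun h => \sw_(a, b <- h) (rho (P m a) (w b)))).

Let TE m w h : T m w h = \sw_(a, b <- h) (rho (P m a) (w b)).
Proof.
have lin1 (w' : 'Hom(H, V)) : lin (fun h => \sw_(a, b <- h) (rho (P m a) (w' b))) by lin_tac.
rewrite /T lin_linfun ?lin_linfun // => k x y; apply/lfunP => z.
rewrite add_lfunE scale_lfunE !lin_linfun //.
have lb : lin (fun w' : 'Hom(H, V) => \sw_(a, b <- z) (rho (P m a) (w' b))).
  apply: lin_tlift_body => a b; apply: lrho2 => c u u'.
  by rewrite add_lfunE scale_lfunE.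
exact: lb.
Qed.

Let iterTE m q w h : (r %| m)%N ->
  iter q.+1 (T m) w h = \sw_(a, b <- h) (rho (P (q.+1 * m) a) (w b)).
Proof.
move=> rm; have lP k := lin_tau_power A tau k.
elim: q h => [|q IHq] h; first by rewrite TE mul1n.
rewrite iterS TE.
transitivity (\sw_(x, y <- h) \sw_(a, b <- y) (rho (P m x * P (q.+1 * m) a) (w b))).
  sw_ext => x y; rewrite IHq (lin_tliftE (u := fun z => rho (P m x) z)); last first.
    by apply: lrho2; lin_tac.
  by sw_ext => a b; rewrite rhoM.
rewrite -(swA A (f := fun x a b => rho (P m x * P (q.+1 * m) a) (w b))); last 3 first.
- by move=> b c; apply: lrho; lin_tac.
- by move=> b c; apply: lrho; lin_tac.
- by move=> b c; apply: lrho2; lin_tac.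
sw_ext => x y; rewrite [(q.+2 * m)%N]mulSn (tau_powerD A _ _ taur rm).
rewrite (lin_tliftE (u := fun z => rho z (w y))) //.
by apply: lrho; lin_tac.
Qed.

Let Te m w : (r %| m)%N -> iter e.+1 (T m) w = T m w.
Proof.
move=> rm; apply/lfunP => h; rewrite iterTE // TE; sw_ext => a b.
rewrite mulSn -{2}(divnK rm) mulnCA [(e * r)%N]mulnC.
by rewrite rho_tau_power_periodn.
Qed.

(** Summing the trace over the [V] factor leaves [h |-> chi(P m h_1) h_2] on [H], to which
    [trace_lcontract] applies. *)
Let traceT m : lfun_trace (T m) = n%:R * lm_char rho (P m L).
Proof.
have lP k := lin_tau_power A tau k.
pose eV (i : 'I_(\dim {:V})) := (vbasis {:V})`_i.
pose eH (l : 'I_n) := (vbasis {:H})`_l.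
pose y l i : 'Hom(H, V) := linfun (fun h : H => coord (vbasis {:H}) l h *: eV i).
have yE l i h : y l i h = coord (vbasis {:H}) l h *: eV i.
  by rewrite /y lin_linfun // => k u u'; rewrite linearP scalerDl scalerA.
have wE (w : 'Hom(H, V)) : w = \sum_l \sum_i coord (vbasis {:V}) i (w (eH l)) *: y l i.
  apply/lfunP => h; rewrite {1}(coord_vbasis (memvf h)) linear_sum sum_lfunE.
  apply: eq_bigr => l _; rewrite sum_lfunE linearZ /=.
  rewrite {1}(coord_vbasis (memvf (w _))) scaler_sumr; apply: eq_bigr => i _.
  by rewrite scale_lfunE yE !scalerA mulrC.
pose p (k : 'I_n * 'I_(\dim {:V})) (w : 'Hom(H, V)) : F^o := coord (vbasis {:V}) k.2 (w (eH k.1)).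
have lp k : lin (p k) by move=> c u u'; rewrite /p add_lfunE scale_lfunE linearP.
rewrite (trace_expand (y := fun k => T m (y k.1 k.2)) lp); last first.
  move=> w; rewrite {1}(wE w) pair_bigA linear_sum; apply: eq_bigr => k _.
  by rewrite linearZ.
pose chiP h : F^o := lm_char rho (P m h).
have lchi : lin chiP.
  move=> c u u'; rewrite /chiP /lm_char lP linearP lfun_traceD.
  by rewrite lfun_traceZ.
pose C := linfun (fun h => \sw_(a, b <- h) ((chiP a : F) *: b)).
have CE h : C h = \sw_(a, b <- h) ((chiP a : F) *: b).
  by rewrite /C lin_linfun //; lin_tac.
rewrite -[RHS]/(n%:R * chiP L) -(trace_lcontract cF ssH intL lchi CE) lfun_traceE.
rewrite -(pair_bigA _ (fun l i => p (l, i) (T m (y l i)))) /=; apply: eq_bigr => l _.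
have lc (U : vectType F) (g : U -> H) : lin g -> lin (fun x => coord (vbasis {:H}) l (g x) : F^o).
  by move=> lg c u u'; rewrite lg linearP.
rewrite CE (lin_tliftE (u := fun z => coord (vbasis {:H}) l z : F^o)); last by apply: lc; lin_tac.
transitivity (\sum_i \sw_(a, b <- eH l)
   (coord (vbasis {:V}) i (rho (P m a) (coord (vbasis {:H}) l b *: eV i)) : F^o)).
  apply: eq_bigr => i _; rewrite /p TE.
  rewrite (lin_tliftE (u := fun z => coord (vbasis {:V}) i z : F^o)); last first.
    by move=> c u u'; rewrite linearP.
  by sw_ext => a b; rewrite yE.
rewrite -tlift_sum; sw_ext => a b; rewrite [RHS]linearZ /= /chiP /lm_char lfun_traceE mulr_suml.
by apply: eq_bigr => i _; rewrite !linearZ /= mulrC.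
Qed.

Lemma indicator_exponent m (z : F) : (r %| m)%N -> e.-primitive_root z ->
  int_adjoin z (n%:R * lm_char rho (P m L)).
Proof.
move=> rm zP; rewrite -traceT; apply: (finite_order_trace cF zP) => w.
exact: Te.
Qed.

End Exponent.

Section TensorPower.

Local Notation d := (\dim {:V}).

Definition mx_coef (q : nat) (i j : 'I_d) (h : H) : F^o :=
  coord (vbasis {:V}) i (rho (iter q tau h) (vbasis {:V})`_j).

Lemma lin_mx_coef q i j : lin (mx_coef q i j).
Proof.
have lt := lin_iter tau q; move=> k x y; rewrite /mx_coef lt !linearP /=.
by rewrite add_lfunE scale_lfunE linearP.
Qed.

Lemma tau_iterM q h k : iter q tau (h * k) = iter q tau h * iter q tau k.
Proof. by case: tauA => _ [_ tM] _ _ _; elim: q => // q IHq; rewrite !iterS IHq tM. Qed.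

Lemma mx_coefM q i j h k :
  mx_coef q i j (h * k) = \sum_l mx_coef q i l h * mx_coef q l j k.
Proof.
rewrite /mx_coef tau_iterM rhoM.
rewrite {1}(coord_vbasis (memvf (rho (iter q tau k) _))) !linear_sum /=.
by apply: eq_bigr => l _; rewrite !linearZ /= mulrC.
Qed.

Fixpoint conv_seq (us : seq (H -> F^o)) (h : H) : F^o :=
  if us is u :: us' then \sw_(a, b <- h) ((u a : F) *: conv_seq us' b) else eps h.

Definition all_lin (us : seq (H -> F^o)) := foldr (fun u Q => lin u /\ Q) True us.

Lemma lin_conv_seq us : all_lin us -> lin (conv_seq us).
Proof.
case: us => [_|u us /= _]; first by move=> k x y; rewrite /= linearP.
by lin_tac.
Qed.

Lemma conv_seq_rcons us u h : all_lin us -> lin u ->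
  conv_seq (rcons us u) h = \sw_(a, b <- h) ((conv_seq us a : F) *: u b).
Proof.
move=> lus lu; elim: us lus h => [_|v us IHus /= [lv lus]] h.
  rewrite /= (sw_epsl A h lu) -[RHS](sw_epsr A h lu).
  by sw_ext => a b; exact: mulrC.
have lcu := lin_conv_seq lus.
transitivity (\sw_(x, y <- h) \sw_(a, b <- y) ((v x : F) *: ((conv_seq us a : F) *: u b))).
  by sw_ext => x y; rewrite IHus // tliftZ.
rewrite -(swA A (f := fun x a b => (v x : F) *: ((conv_seq us a : F) *: u b))); [|lin_tac..].
sw_ext => x y; rewrite /= -tlift_scalel; sw_ext => a b.
by rewrite -[RHS]/((v a * conv_seq us b : F) *: u y) -scalerA.
Qed.

Lemma conv_seq_tau us h : all_lin us ->
  conv_seq us (tau h) = conv_seq [seq (fun x => u (tau x)) | u <- us] h.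
Proof.
case: tauA => _ _ tD teps _.
elim: us h => [|u us IHus] h; first by move=> _; exact: teps.
move=> /= [lu lus].
have lcu := lin_conv_seq lus.
rewrite tD tlift_tmap; last by lin_tac.
by sw_ext => a b; rewrite IHus.
Qed.

Lemma tau_int : tau L = L.
Proof.
case: tauA => [[tau' tau'K tauK] [t1 tM] tD teps _].
case: intL => hL Lh epsL.
have htL h : h * tau L = eps h *: tau L.
  by rewrite -{1}(tauK h) -tM hL linearZ /= -teps tauK.
by have := htL L; rewrite Lh teps epsL !scale1r => <-.
Qed.

Lemma conv_seq_rot us u : all_lin us -> lin u ->
  conv_seq (rcons us u) L = conv_seq (u :: us) L.
Proof.
move=> lus lu; have lcu := lin_conv_seq lus.
rewrite conv_seq_rcons //= -(int_cocomm cF ssH intL); last by lin_tac.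
by sw_ext => a b; exact: mulrC.
Qed.

(** Through [conv_seq], the matrix entry at [(s, t)] of [H] acting on the tensor product of the
    twists of [V] by [tau^q, tau^(q+1), ...]. *)
Fixpoint mx_word (q : nat) (s t : seq 'I_d) : seq (H -> F^o) :=
  match s, t with
  | i :: s', j :: t' => mx_coef q i j :: mx_word q.+1 s' t'
  | _, _ => [::]
  end.

Lemma all_lin_mx_word q s t : all_lin (mx_word q s t).
Proof.
elim: s q t => [|i s IHs] q [|j t] //=; split=> //; exact: lin_mx_coef.
Qed.

Lemma mx_word_rcons q s t i j : size s = size t ->
  mx_word q (rcons s i) (rcons t j) =
  rcons (mx_word q s t) (mx_coef (q + size s) i j).
Proof.
elim: s q t => [|k s IHs] q [|l t] //=; first by rewrite addn0.
by case=> st; rewrite IHs // addSnnS.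
Qed.

Lemma mx_coef_tau q i j h : mx_coef q i j (tau h) = mx_coef q.+1 i j h.
Proof. by rewrite /mx_coef iterSr. Qed.

Lemma conv_mx_word_tau q s t h :
  conv_seq (mx_word q s t) (tau h) = conv_seq (mx_word q.+1 s t) h.
Proof.
rewrite conv_seq_tau; last exact: all_lin_mx_word.
elim: s q t h => [|i s IHs] q [|j t] h //=.
by sw_ext => a b; rewrite mx_coef_tau IHs.
Qed.

Definition tensor_kernel (s t : seq 'I_d) : F := conv_seq (mx_word 0 s t) L.

(** Cocommutativity of [L] moves the last factor to the front; replacing [L] by [tau L = L] raises
    each twist by one, and the front twist becomes [tau^m = 1]. *)
Lemma tensor_kernel_rot s t : size s = size t -> (r %| size s)%N ->
  tensor_kernel (rot 1 s) (rot 1 t) = tensor_kernel s t.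
Proof.
case: s t => [|i s] [|j t] //= [st] rs; rewrite /tensor_kernel !rot1_cons.
have itq m x : (r %| m)%N -> iter m tau x = x.
  by move=> /dvdnP[q ->]; elim: q => // q IHq; rewrite mulSn iterD IHq.
rewrite mx_word_rcons // conv_seq_rot; last exact: lin_mx_coef.
  rewrite add0n -{1}tau_int -[LHS]/(conv_seq (mx_coef (size s) i j :: mx_word 0 s t) (tau L)).
  rewrite conv_seq_tau; last by split; [exact: lin_mx_coef | exact: all_lin_mx_word].
  rewrite /=; sw_ext => a b; rewrite mx_coef_tau; congr (_ *: _).
    by rewrite /mx_coef itq.
  by rewrite -conv_seq_tau ?conv_mx_word_tau //; exact: all_lin_mx_word.
exact: all_lin_mx_word.
Qed.

Lemma big_tupleS (T : finType) (R : nmodType) m (G : seq T -> R) :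
  \sum_(s : m.+1.-tuple T) G s = \sum_i \sum_(s : m.-tuple T) G (i :: s).
Proof.
rewrite pair_bigA /=; pose h (p : T * m.-tuple T) := [tuple of p.1 :: p.2].
rewrite (reindex h) //=; exists (fun s : m.+1.-tuple T => (thead s, [tuple of behead s])).
  by move=> [i s] _; rewrite /h /=; congr (_, _); apply: val_inj.
by move=> s _; rewrite /h /=; apply: val_inj; rewrite [in RHS](tuple_eta s).
Qed.

Lemma tensor_kernel_mul m q (s u : seq 'I_d) h k : size s = m -> size u = m ->
  \sum_(t : m.-tuple 'I_d)
     conv_seq (mx_word q s t) h * conv_seq (mx_word q t u) k =
  conv_seq (mx_word q s u) (h * k).
Proof.
elim: m q s u h k => [|m IHm] q s u h k.
  move=> /size0nil -> /size0nil ->.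
  rewrite (big_pred1 [tuple]) => [|t]; last by apply/esym/eqP; exact: tuple0.
  by rewrite /= counitM.
case: s => // i s [sm]; case: u => // j u [um].
rewrite (big_tupleS _ (fun t => conv_seq (mx_word q (i :: s) t) h * conv_seq (mx_word q t (j :: u)) k)) /=.
have lc q' s' t' := lin_conv_seq (all_lin_mx_word q' s' t').
have lm q' i' j' := lin_mx_coef q' i' j'.
have l1 := lm q i j; have l2 := lc q.+1 s u.
rewrite swM; last by lin_tac.
transitivity (\sum_l \sum_(t : m.-tuple 'I_d) \sw_(a, b <- h) \sw_(c, e <- k)
   ((mx_coef q i l a * conv_seq (mx_word q.+1 s t) b : F) *:
    ((mx_coef q l j c : F) *: conv_seq (mx_word q.+1 t u) e))).
  apply: eq_bigr => l _; apply: eq_bigr => t _.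
  rewrite -[LHS]/((_ : F) *: (_ : F^o)) -tlift_scalel; sw_ext => a b.
  by rewrite tliftZ.
rewrite pair_bigA -tlift_sum; sw_ext => a b; rewrite -tlift_sum; sw_ext => c e.
rewrite mx_coefM -IHm // -[RHS]/(_ * _) mulr_suml -(pair_bigA _ (fun l (t : m.-tuple 'I_d) =>
  (mx_coef q i l a * conv_seq (mx_word q.+1 s t) b : F) *:
    ((mx_coef q l j c : F) *: conv_seq (mx_word q.+1 t u) e))) /=.
apply: eq_bigr => l _; rewrite mulr_sumr; apply: eq_bigr => t _.
rewrite -[LHS]/(_ * _ * (_ * _)); exact: mulrACA.
Qed.

(** Linking each column index to the next row index turns the tensor product of matrices into their
    ordinary product. *)
Lemma mx_word_path m q i j h :
  \sum_(s : m.-tuple 'I_d) conv_seq (mx_word q (i :: s) (rcons s j)) h =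
  mx_coef 0 i j (conv_prod A (fun k => iter (q + k) tau) m.+1 h).
Proof.
have lm q' i' j' := lin_mx_coef q' i' j'.
elim: m q i h => [|m IHm] q i h.
  rewrite (big_pred1 [tuple]) => [|t]; last by apply/esym/eqP; exact: tuple0.
  have l1 := lm q i j.
  transitivity (mx_coef q i j h).
    by rewrite -[RHS](sw_epsr A h l1); sw_ext => a b; exact: mulrC.
  rewrite /mx_coef; congr (coord _ _ (rho _ _)).
  have lt := lin_iter tau q; rewrite /= -[LHS](sw_epsr A h lt).
  by sw_ext => a b; rewrite addn0 -scalerAr mulr1.
rewrite (big_tupleS _ (fun s => conv_seq (mx_word q (i :: s) (rcons s j)) h)) /=.
pose f1 k := iter (q.+1 + k) tau.
have lf1 : lin (conv_prod A f1 m.+1) by apply: lin_conv_prod => k; apply: lin_iter.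
have lt := lin_iter tau q; have l0 := lm 0%N i j.
rewrite -[X in mx_coef 0 i j X](@eq_tlift _ _ _ _ (fun a b => iter q tau a * conv_prod A f1 m.+1 b)).
  rewrite (lin_tliftE _ _ l0).
  transitivity (\sum_l \sum_(s : m.-tuple 'I_d) \sw_(a, b <- h)
     ((mx_coef q i l a : F) *: conv_seq (mx_word q.+1 (l :: s) (rcons s j)) b)) => //.
  transitivity (\sw_(a, b <- h) \sum_l
     ((mx_coef q i l a : F) *: mx_coef 0 l j (conv_prod A f1 m.+1 b))).
    rewrite tlift_sum; apply: eq_bigr => l _; rewrite -tlift_sum.
    by sw_ext => a b; rewrite -scaler_sumr IHm.
  by sw_ext => a b; rewrite mx_coefM; apply: eq_bigr.
move=> a b; rewrite addn0; congr (_ * _).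
apply: (@eq_conv_prod F H A f1 (fun k => iter (q + k.+1) tau) m.+1 b).
by move=> k x; rewrite /f1 addSnnS.
Qed.

Section Cyclic.

Variable m : nat.
Hypothesis rm : (r %| m)%N.

Let W : vectType F := {ffun m.-tuple 'I_d -> F^o}.

(* The action of the integral on [V^{(x) m}] composed with a cyclic shift. *)
Let B : 'End(W) := linfun (fun w : W =>
  [ffun s : m.-tuple 'I_d => \sum_(t : m.-tuple 'I_d) tensor_kernel s (rot 1 t) * w t] : W).

Let BE (w : W) s : B w s = \sum_(t : m.-tuple 'I_d) tensor_kernel s (rot 1 t) * w t.
Proof.
rewrite /B lin_linfun ?ffunE // => k x y; apply/ffunP => u; rewrite !ffunE.
rewrite scaler_sumr -big_split; apply: eq_bigr => t _ /=.
by rewrite !ffunE mulrDr; congr (_ + _); exact: mulrCA.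
Qed.

(** The kernel commutes with rotation and is idempotent because [L * L = L], so powers of [B] only
    accumulate shifts. *)
Let iterBE q (w : W) s : iter q.+1 B w s =
  \sum_(t : m.-tuple 'I_d) tensor_kernel s (iter q.+1 (rot 1) t) * w t.
Proof.
elim: q s => [|q IHq] s; first exact: BE.
rewrite iterS BE; under eq_bigr do rewrite IHq mulr_sumr.
rewrite exchange_big; apply: eq_bigr => u _ /=.
under eq_bigr do rewrite mulrA.
rewrite -mulr_suml; congr (_ * _).
have szit k (v : seq 'I_d) : size (iter k (rot 1) v) = size v.
  by elim: k => // k IHk; rewrite iterS size_rot.
transitivity (\sum_(t : m.-tuple 'I_d) tensor_kernel s t *
                tensor_kernel t (iter q.+2 (rot 1) u)).
  pose h (t : m.-tuple 'I_d) := [tuple of rot 1 t].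
  rewrite [RHS](reindex h) /=.
    apply: eq_bigr => t _; congr (_ * _).
    by rewrite -[LHS]tensor_kernel_rot ?size_rot ?szit ?size_tuple //.
  exists (fun t : m.-tuple 'I_d => [tuple of rotr 1 t]) => t _.
    by apply: val_inj; rewrite /= rotK.
  by apply: val_inj; rewrite /= rotrK.
rewrite /tensor_kernel (tensor_kernel_mul 0 L L) ?size_tuple ?szit ?size_tuple //.
by case: intL => -> _ ->; rewrite scale1r.
Qed.

Let Bm (w : W) : iter m.+1 B w = B w.
Proof.
apply/ffunP => s; rewrite iterBE BE; apply: eq_bigr => t _.
have itrot k : (k <= m)%N -> iter k (rot 1) t = rot k t.
  elim: k => [|k IHk] km; first by rewrite rot0.
  by rewrite iterS IHk ?(ltnW km) // -rotS ?size_tuple.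
by rewrite iterS itrot // -{2}(size_tuple t) rot_size.
Qed.

(** The diagonal entries pair [t] with its rotation, which closes the paths of [mx_word_path] into
    the trace of [rho (P m L)]. *)
Let traceB : (0 < m)%N -> lfun_trace B = lm_char rho (P m L).
Proof.
move=> m0.
pose y (t : m.-tuple 'I_d) : W := [ffun s : m.-tuple 'I_d => tensor_kernel s (rot 1 t)].
rewrite (trace_expand (p := fun t (w : W) => w t : F^o) (y := y)).
- rewrite (eq_bigr (fun t : m.-tuple 'I_d => tensor_kernel t (rot 1 t))); last first.
    by move=> t _; rewrite ffunE.
  case: m m0 => // m' _.
  rewrite (big_tupleS _ (fun t => tensor_kernel t (rot 1 t))) /= /lm_char lfun_traceE.
  apply: eq_bigr => i _; rewrite /tensor_kernel.
  by under eq_bigr do rewrite rot1_cons; rewrite mx_word_path.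
- by move=> t k u v; rewrite !ffunE.
move=> w; apply/ffunP => s; rewrite BE sum_ffunE; apply: eq_bigr => t _.
by rewrite !ffunE; exact: mulrC.
Qed.

Lemma indicator_integral (z : F) : m.-primitive_root z ->
  int_adjoin z (lm_char rho (P m L)).
Proof.
move=> zP; rewrite -traceB ?(prim_order_gt0 zP) //.
exact: (finite_order_trace cF zP Bm).
Qed.

End Cyclic.
End TensorPower.

Theorem twisted_indicator_exponent (e m : nat) :
  (forall h, rho (P (r * e) h) = eps h *: \1%VF) ->
  (0 < m)%N -> (r %| m)%N ->
  twisted_indicator A L (lm_char rho) tau (m + r * e) =
    twisted_indicator A L (lm_char rho) tau m /\
  (forall z : F, e.-primitive_root z ->
     int_adjoin z (twisted_indicator A L (lm_char rho) tau m)).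
Proof.
move=> expe m0 rm; rewrite /twisted_indicator !twisted_powerE ?addn_gt0 ?m0 //.
split=> [|z zP]; first by rewrite /lm_char (rho_tau_power_period expe).
have em0 : (0 < e * m)%N by rewrite muln_gt0 m0 (prim_order_gt0 zP).
(* One root [w] of order [e * m] hosts both facts: [w ^+ m] has order [e] and [w ^+ e] has order
   [m]. *)
have [w wP] := closed_prim_root cF em0.
have wmP : e.-primitive_root (w ^+ m).
  by have := dvdn_prim_root wP (dvdn_mulr m (dvdnn e)); rewrite mulKn ?(prim_order_gt0 zP).
have weP : m.-primitive_root (w ^+ e).
  by have := dvdn_prim_root wP (dvdn_mull e (dvdnn m)); rewrite mulnK.
have n0 : (0 < n)%N.
  rewrite lt0n dimv_eq0; apply/eqP => H0; have := memvf (1 : H).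
  by rewrite H0 memv0 oner_eq0.
apply: (int_adjoin_prim_root wmP zP).
apply: (int_adjoin_pure cF wP n0).
  exact: int_adjoin_exp (indicator_integral rm weP).
exact: indicator_exponent expe m _ rm wmP.
Qed.

End TwistedIndicator.

Theorem corollary4p2 (F : closedFieldType) (charF0 : [pchar F] =i pred0)
    (H : falgType F) (A : hopf_algebra H) (ssH : semisimple_algebra H)
    (tau : 'End(H)) (tau_aut : hopf_automorphism A tau)
    (r : nat) (tau_order : has_order tau r)
    (Lambda : H) (intLambda : normalized_integral A Lambda) :
  (forall (V : vectType F) (rho : lmodule_str H V) (e : nat),
     is_twisted_exponent_mod A tau r rho e ->
     forall m : nat, (0 < m)%N -> (r %| m)%N ->
       twisted_indicator A Lambda (lm_char rho) tau (m + r * e)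
         = twisted_indicator A Lambda (lm_char rho) tau m
       /\ (forall z : F, e.-primitive_root z ->
             int_adjoin z (twisted_indicator A Lambda (lm_char rho) tau m)))
  /\
  (forall e : nat, is_twisted_exponent A tau r e ->
     forall (V : vectType F) (rho : lmodule_str H V),
     forall m : nat, (0 < m)%N -> (r %| m)%N ->
       twisted_indicator A Lambda (lm_char rho) tau (m + r * e)
         = twisted_indicator A Lambda (lm_char rho) tau m
       /\ (forall z : F, e.-primitive_root z ->
             int_adjoin z (twisted_indicator A Lambda (lm_char rho) tau m))).
Proof.
have [r0 taur _] : least_pos (fun k => forall h : H, iter k tau h = h) r := tau_order.
have powE k h : (0 < k)%N ->
    twisted_power A (twisting_map A tau) (k * r) h = tau_power A tau (r * k) h.
  move=> k0; rewrite (twisting_mapE charF0 ssH intLambda) mulnC.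
  by rewrite twisted_powerE // muln_gt0 r0.
split=> [V rho e [e0 expe _] m m0 rm | e [e0 expe _] V rho m m0 rm];
  apply: (twisted_indicator_exponent charF0 ssH intLambda tau_aut taur) => // h.
  by rewrite -powE.
by rewrite -powE // expe linearZ /= lm_act1.
Qed.
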